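(* Let $G$ be a finite simple graph that can be embedded in a surface of nonnegative characteristic and suppose that for some two-element subset $\{i,j\}\subseteq\{3,4,6\}$ the graph $G$ contains neither $i$-cycles nor $j$-cycles. Then $G$ has a matching $M$ such that each of the choice number $ch(G-M)$, the paint number $\chi_P(G-M)$, the DP-chromatic number $\chi_{DP}(G-M)$ and the Alon–Tarsi number $AT(G-M)$ is at most $3$.
   Context: All graphs are finite and simple. A surface of nonnegative characteristic is one of the Euclidean plane (equivalently the sphere), the projective plane, the torus, or the Klein bottle. A $k$-cycle is a cycle (as a subgraph) with $k$ vertices. $G-M$ denotes $G$ with the edges of $M$ deleted. Choice number $ch(G)$: the least $k$ such that for every assignment $L$ of lists of $k$ colors to the vertices there is a proper coloring $\varphi$ with $\varphi(v)\in L(v)$ for all $v$. Paint number $\chi_P(G)$: the least $k$ such that Painter has a winning strategy in the following game. Each vertex starts with $k$ tokens, all vertices uncolored. In each round Lister marks a nonempty set of uncolored vertices and removes one token from each marked vertex; Painter then colors an independent subset of the marked vertices. Lister wins if at the end of some round there is an uncolored vertex with no tokens left; Painter wins if all vertices get colored. DP-chromatic number $\chi_{DP}(G)$: the least $k$ such that for every choice, for each edge $uv\in E(G)$, of a (possibly empty) matching $M_{uv}$ between $\{u\}\times\{1,\dots,k\}$ and $\{v\}\times\{1,\dots,k\}$, there is a map $\varphi:V(G)\to\{1,\dots,k\}$ such that for every edge $uv$ the pair $(u,\varphi(u))(v,\varphi(v))$ is not in $M_{uv}$. Alon–Tarsi number $AT(G)$: the least $k$ such that $G$ has an orientation $D$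 with maximum out-degree at most $k-1$ for which the number of spanning Eulerian subdigraphs (every vertex has in-degree equal to out-degree; not necessarily connected) of $D$ with an even number of arcs differs from the number of those with an odd number of arcs. *)

(* Defs.v *)
From HB Require Import structures.
From mathcomp Require Import all_boot all_order all_algebra.

Set Implicit Arguments.
Unset Strict Implicit.
Unset Printing Implicit Defensive.

Record sgraph := SGraph {
  vertex :> finType;
  adj : rel vertex;
  adj_sym : symmetric adj;
  adj_irr : irreflexive adj }.

Definition has_cycle (G : sgraph) (k : nat) : Prop :=
  2 < k /\ exists c : seq G, size c = k /\ ucycle (@adj G) c.

Definition edges (G : sgraph) : {set {set G}} :=
  [set [set p.1; p.2] | p in [set p : G * G | adj p.1 p.2]].

Definition matching (G : sgraph) (M : {set {set G}}) : Prop :=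
  M \subset edges G /\ trivIset M.

Definition independent (G : sgraph) (I : {set G}) : bool :=
  [forall u in I, forall v in I, ~~ adj u v].

Section DeleteEdges.
Variables (G : sgraph) (M : {set {set G}}).

Definition del_adj : rel G := [rel u v | adj u v && ([set u; v] \notin M)].

Lemma del_adj_sym : symmetric del_adj.
Proof. by move=> u v; rewrite /del_adj /= adj_sym setUC. Qed.

Lemma del_adj_irr : irreflexive del_adj.
Proof. by move=> u; rewrite /del_adj /= adj_irr. Qed.

Definition delete_edges : sgraph := SGraph del_adj_sym del_adj_irr.
End DeleteEdges.

(* A cell decomposition of a connected closed surface, orientable or not, given
   by its flags, i.e. its mutually incident triples (vertex, edge, face), or the
   triangles of its barycentric subdivision. [flip0], [flip1] and [flip2] cross
   to the flag differing only in the vertex, the edge and the face respectively.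
   Loops, multiple edges and faces meeting themselves are allowed: the four
   flags of an edge are distinct even where the cells they name coincide. *)
Record cell_decomposition := CellDecomposition {
  flag :> finType;
  flip0 : flag -> flag;
  flip1 : flag -> flag;
  flip2 : flag -> flag;
  flip0K : involutive flip0;
  flip1K : involutive flip1;
  flip2K : involutive flip2;
  flip0_neq : forall x, flip0 x != x;
  flip1_neq : forall x, flip1 x != x;
  flip2_neq : forall x, flip2 x != x;
  flip02C : forall x, flip0 (flip2 x) = flip2 (flip0 x);
  flip02_neq : forall x, flip0 x != flip2 x;
  flag_nonempty : 0 < #|flag|;
  flag_connected : forall x y,
    connect [rel u v | v \in [:: flip0 u; flip1 u; flip2 u]] x y }.

Section CellDecompositionTheory.
Variable D : cell_decomposition.

Definition flip_rel (f g : D -> D) : rel D := [rel x y | y \in [:: f x; g x]].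

Definition same_vertex : rel D := connect (flip_rel (@flip1 D) (@flip2 D)).

Definition nb_vertices : nat := n_comp (flip_rel (@flip1 D) (@flip2 D)) predT.
Definition nb_edges : nat := n_comp (flip_rel (@flip0 D) (@flip2 D)) predT.
Definition nb_faces : nat := n_comp (flip_rel (@flip0 D) (@flip1 D)) predT.

Definition euler_char : int :=
  (nb_vertices%:Z - nb_edges%:Z + nb_faces%:Z)%R.

Definition orientable : Prop :=
  exists s : D -> bool, forall x,
    [/\ s (flip0 x) = ~~ s x, s (flip1 x) = ~~ s x & s (flip2 x) = ~~ s x].
End CellDecompositionTheory.

(* The Euclidean plane and the sphere have the same embeddable graphs. *)
Inductive nonneg_surface := Sphere | ProjectivePlane | Torus | KleinBottle.

Definition surface_char (S : nonneg_surface) : int :=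
  match S with
  | Sphere => 2%:Z
  | ProjectivePlane => 1%:Z
  | Torus | KleinBottle => 0%:Z
  end.

Definition surface_orientable (S : nonneg_surface) : bool :=
  match S with
  | Sphere | Torus => true
  | ProjectivePlane | KleinBottle => false
  end.

(* By the classification of closed surfaces, the Euler characteristic and
   orientability determine the surface that [D] decomposes. *)
Definition decomposes (D : cell_decomposition) (S : nonneg_surface) : Prop :=
  euler_char D = surface_char S /\ (orientable D <-> surface_orientable S).

(* A graph drawn on a closed surface extends, by further vertices and edges, to
   the 1-skeleton of a cell decomposition; so [G] embeds in [S] when it is a
   subgraph of such a 1-skeleton. [G] need not be connected, nor its faces be
   discs. A vertex of [G] is sent to a flag at its image; as [G] is simple,
   distinct edges of [G] automatically go to distinct edges of [D]. *)
Definition embeddable (G : sgraph) (S : nonneg_surface) : Prop :=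
  exists (D : cell_decomposition) (h : G -> D),
    [/\ decomposes D S,
        forall u v, same_vertex (h u) (h v) -> u = v
      & forall u v, adj u v -> exists x : D,
          same_vertex (h u) x /\ same_vertex (h v) (flip0 x)].

Definition choosable (G : sgraph) (k : nat) : Prop :=
  forall (C : finType) (L : G -> {set C}), (forall v, #|L v| = k) ->
  exists phi : G -> C,
    (forall v, phi v \in L v) /\ (forall u v, adj u v -> phi u != phi v).

(* [painter_wins U t]: Painter wins from the position at the start of a round
   where [U] is the set of uncolored vertices and [t] counts the tokens left.
   [answer S] is Painter's reply when Lister marks [S]. Requiring a token on
   each vertex of [U] says that Lister has not won at the end of the previous
   round (nor, for the initial position, before the first one). *)
Inductive painter_wins (G : sgraph) : {set G} -> (G -> nat) -> Prop :=
| PainterDone t : painter_wins set0 t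
| PainterRound (U : {set G}) (t : G -> nat) (answer : {set G} -> {set G}) :
    (forall v, v \in U -> 0 < t v) ->
    (forall S : {set G}, S != set0 -> S \subset U -> answer S \subset S) ->
    (forall S : {set G}, S != set0 -> S \subset U -> independent (answer S)) ->
    (forall S : {set G}, S != set0 -> S \subset U ->
       painter_wins (U :\: answer S) (fun v => t v - (v \in S))) ->
    painter_wins U t.

Definition paintable (G : sgraph) (k : nat) : Prop :=
  painter_wins [set: G] (fun=> k).

(* [M u v a b] says that [(u, a)] and [(v, b)] are joined in the matching of the
   edge [uv]; the first condition makes [M u v] and [M v u] the same matching. *)
Definition DP_cover (G : sgraph) (k : nat) (M : G -> G -> rel 'I_k) : Prop :=
  forall u v, adj u v ->
    [/\ forall a b, M u v a b = M v u b a,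
        forall a b b', M u v a b -> M u v a b' -> b = b'
      & forall a a' b, M u v a b -> M u v a' b -> a = a'].

Definition DP_colorable (G : sgraph) (k : nat) : Prop :=
  forall M : G -> G -> rel 'I_k, DP_cover M ->
  exists phi : G -> 'I_k, forall u v, adj u v -> ~~ M u v (phi u) (phi v).

Section Orientations.
Variable G : sgraph.
Implicit Types (D H : {set G * G}).

Definition orientation D : Prop :=
  (forall u v, (u, v) \in D -> adj u v) /\
  (forall u v, adj u v -> ((u, v) \in D) (+) ((v, u) \in D)).

Definition outdeg D (v : G) : nat := #|[set w | (v, w) \in D]|.
Definition indeg D (v : G) : nat := #|[set w | (w, v) \in D]|.

Definition eulerian_subs D : {set {set G * G}} :=
  [set H : {set G * G} | (H \subset D) && [forall v, indeg H v == outdeg H v]].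

Definition AT_orientable (k : nat) : Prop :=
  exists D, [/\ orientation D, forall v, outdeg D v < k
    & #|[set H in eulerian_subs D | ~~ odd #|H|]|
      <> #|[set H in eulerian_subs D | odd #|H|]|].
End Orientations.

Definition is_least (P : nat -> Prop) (k : nat) : Prop :=
  P k /\ forall m, P m -> k <= m.

Definition is_choice_number (G : sgraph) : nat -> Prop :=
  is_least (choosable G).
Definition is_paint_number (G : sgraph) : nat -> Prop :=
  is_least (paintable G).
Definition is_DP_chromatic_number (G : sgraph) : nat -> Prop :=
  is_least (DP_colorable G).
Definition is_Alon_Tarsi_number (G : sgraph) : nat -> Prop :=
  is_least (@AT_orientable G).

(* Main.v *)
Require Import Defs.
From HB Require Import structures.
From mathcomp Require Import all_boot all_order all_algebra.
From mathcomp Require Import zify.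
From Stdlib Require Import Classical.

(* A matching M with G - M 2-degenerate suffices: greedy coloring, greedy play
   and an acyclic orientation then bound all four parameters by 3. Let A be a
   minimal vertex set whose induced subgraph has no such M. Its vertices have
   degree at least 3, vertices of degree 3 are not adjacent, no cycle alternates
   between degrees 3 and 4, and a triangle of degrees 3, 4, 4 has no further
   3-vertex next to one of its 4-vertices: in each case the vertices concerned
   could be put last in the order, with a suitable matching among them.

   Drawn on a surface of nonnegative characteristic, the subgraph satisfies
   n - e + f >= 0, where f counts the components of the complement, which need
   not be discs. Discharging refutes this. Without 3- and 4-cycles regions have
   length at least 5. Without 3- and 6-cycles regions of length 4 share no edge,
   and the subgraph between 3- and 4-vertices is a forest. Without 4- and
   6-cycles the regions are triangles or have length at least 5, those next to a
   triangle have length at least 7, and vertices of degree at least 4 can pay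
   for their 3-neighbors. *)

Set Implicit Arguments.
Unset Strict Implicit.
Unset Printing Implicit Defensive.

(** * Euler's inequality for the regions of a subgraph *)

(** The graph is only part of the 1-skeleton of a cell decomposition, so neither Euler's formula nor
    facial walks are available for its subgraph. Euler's inequality comes from restoring the missing
    edges of the 1-skeleton one at a time: an edge that joins two components separates no region,
    and any other edge splits at most one region. Facial walks are replaced by two local facts at a
    vertex: a union of regions has an even number of boundary edges there, and a union without
    boundary edges there contains all sides or none. With minimum degree 3 this excludes dead ends,
    so the boundary of every region contains a cycle, and the excluded cycle lengths bound its size
    from below.

    Parity enters once more in the discharging, where it caps the number of quadrilateral or
    triangular edges at a vertex of odd degree. All charges are natural numbers, whence the scaled
    amounts 10, 40 and 210 that a region hands out. *)

Section Components.
Variable T : finType.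
Implicit Types (e : rel T) (x y a b : T).

Lemma n_comp_predT e : n_comp e predT = #|[set x | roots e x]|.
Proof. by apply: eq_card => x; rewrite !inE andbT. Qed.

Lemma leq_n_comp e e' : connect_sym e -> connect_sym e' ->
  subrel e (connect e') -> n_comp e' predT <= n_comp e predT.
Proof.
move=> sym_e sym_e' sub_ee'; rewrite !n_comp_predT.
have sub y z : connect e y z -> connect e' y z by apply: connect_sub.
apply: leq_trans (leq_imset_card (fingraph.root e') [set x | roots e x]).
apply/subset_leq_card/subsetP=> y; rewrite inE => /eqP y_root.
apply/imsetP; exists (fingraph.root e y); first by rewrite inE (fingraph.roots_root sym_e).
have: connect e' y (fingraph.root e y) by apply: sub; apply: connect_root.
by move/(fingraph.rootP sym_e') => <-; rewrite y_root.
Qed.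

(** Up to connectivity [e'] has only the link between [a] and [b] beyond [e], so two roots of [e]
    fall into one class of [e'] only if one of them is the root of [b]. *)
Lemma leq_n_comp_add e e' a b : connect_sym e -> connect_sym e' ->
  (forall x y, e' x y -> [|| connect e x y, connect e x a && connect e b y
                           | connect e x b && connect e a y]) ->
  n_comp e predT <= (n_comp e' predT).+1.
Proof.
move=> sym_e sym_e' sub_e'e; rewrite !n_comp_predT.
pose P x y := [|| connect e x y, connect e x a && connect e b y
                           | connect e x b && connect e a y].
have Ptrans x y z : P x y -> e' y z -> P x z.
  move=> Pxy /sub_e'e Pyz; move: Pxy Pyz; rewrite /P.
  case/or3P=> [xy|/andP[xa yb]|/andP[xb ya]].
  - by case/or3P=> [yz|/andP[ya bz]|/andP[yb az]];
      rewrite ?(connect_trans xy yz) ?(connect_trans xy ya) ?bz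
              ?(connect_trans xy yb) ?az ?orbT.
  - case/or3P=> [yz|/andP[ya bz]|/andP[_ az]].
    + by rewrite xa (connect_trans yb yz) orbT.
    + by rewrite xa bz orbT.
    + by rewrite (connect_trans xa az).
  - case/or3P=> [yz|/andP[_ bz]|/andP[yb az]].
    + by rewrite xb (connect_trans ya yz) !orbT.
    + by rewrite (connect_trans xb bz).
    + by rewrite xb az !orbT.
have Pconnect x y : connect e' x y -> P x y.
  case/connectP=> p; elim/last_ind: p y => [|p z IH] y.
    by move=> _ ->; rewrite /P connect0.
  rewrite rcons_path last_rcons => /andP[xp pz] ->.
  exact: Ptrans (IH _ xp erefl) pz.
pose A := [set x | roots e x] :\ fingraph.root e b.
apply: leq_trans (_ : #|A|.+1 <= _).
  by rewrite (cardsD1 (fingraph.root e b)) -add1n leq_add2r; case: (_ \in _).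
rewrite ltnS -(card_in_imset (f := fingraph.root e') (D := A)); last first.
  move=> x y; rewrite !inE => /andP[xb /eqP xr] /andP[yb /eqP yr] xy.
  have /Pconnect : connect e' x y by apply/(fingraph.rootP sym_e').
  case/or3P=> [|/andP[_ by_]|/andP[xb' _]].
  - by move/(fingraph.rootP sym_e); rewrite xr yr.
  - by case/eqP: yb; rewrite -yr; apply/esym/(fingraph.rootP sym_e).
  - by case/eqP: xb; rewrite -xr; apply/(fingraph.rootP sym_e).
apply/subset_leq_card/subsetP=> _ /imsetP[x _ ->].
by rewrite inE (fingraph.roots_root sym_e').
Qed.

End Components.

Section EdgeSubsets.
Variable D : cell_decomposition.
Implicit Types (x y z : D) (K S W : {set D}).

Definition edge_closed K :=
  forall x, (flip0 x \in K) = (x \in K) /\ (flip2 x \in K) = (x \in K).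

(** [K] is a set of edges, each given by its four flags. The classes are the components of the graph
    with edge set [K] on all vertices of [D]: [flip0] traverses an edge, [flip1] and [flip2] turn
    around a vertex. *)
Definition component_rel K : rel D :=
  [rel x y | [|| y == flip1 x, y == flip2 x | (x \in K) && (y == flip0 x)]].

(** The dual relation: an edge may be crossed only outside [K], so the classes are the pieces of the
    surface cut along [K]. *)
Definition region_rel K : rel D :=
  [rel x y | [|| y == flip0 x, y == flip1 x | (x \notin K) && (y == flip2 x)]].

Lemma involutive_eq (f : D -> D) x y : involutive f -> (y == f x) = (x == f y).
Proof. by move=> fK; apply/eqP/eqP=> ->; rewrite fK. Qed.

Lemma component_rel_sym K : edge_closed K -> connect_sym (component_rel K).
Proof.
move=> clK; apply: sym_connect_sym => x y; rewrite /component_rel /region_rel /=.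
rewrite (involutive_eq _ _ (@flip1K D)) (involutive_eq _ _ (@flip2K D)).
congr [|| _, _ | _]; rewrite (involutive_eq _ _ (@flip0K D)).
by apply/andP/andP=> -[xK /eqP eq_x]; move: xK; rewrite {}eq_x (clK _).1.
Qed.

Lemma region_rel_sym K : edge_closed K -> connect_sym (region_rel K).
Proof.
move=> clK; apply: sym_connect_sym => x y; rewrite /component_rel /region_rel /=.
rewrite (involutive_eq _ _ (@flip1K D)) (involutive_eq _ _ (@flip0K D)).
congr [|| _, _ | _]; rewrite (involutive_eq _ _ (@flip2K D)).
by apply/andP/andP=> -[xK /eqP eq_x]; move: xK; rewrite {}eq_x (clK _).2.
Qed.

Lemma flip_rel_sym (f g : D -> D) : involutive f -> involutive g ->
  connect_sym (flip_rel f g).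
Proof.
move=> fK gK; apply: sym_connect_sym => x y; rewrite /flip_rel /= !inE.
by rewrite (involutive_eq _ _ fK) (involutive_eq _ _ gK).
Qed.

Lemma even_involution (f : D -> D) S : involutive f -> (forall x, f x != x) ->
  (forall x, x \in S -> f x \in S) -> ~~ odd #|S|.
Proof.
move=> fK f_neq; have [n] := ubnP #|S|; elim: n S => // n IH S leSn Sf.
have [->|[x xS]] := set_0Vmem S; first by rewrite cards0.
have fxS : f x \in S :\ x by rewrite !inE f_neq Sf.
rewrite (cardsD1 x) xS (cardsD1 (f x)) fxS /= negbK; apply: IH => [|y].
  by move: leSn; rewrite (cardsD1 x) xS (cardsD1 (f x)) fxS; lia.
rewrite !inE => /and3P[y_fx y_x yS]; rewrite Sf // andbT.
rewrite (inj_eq (can_inj fK)) y_x /=; apply: contra y_fx => /eqP <-.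
by rewrite fK.
Qed.

(* [S] is a union of regions and [W] a union of vertices: each corner of [S] in
   [W] contributes two flags, so those on the boundary of [S] are evenly many. *)
Lemma even_boundary S W : (forall x, (flip1 x \in S) = (x \in S)) ->
  (forall x, (flip1 x \in W) = (x \in W)) ->
  (forall x, (flip2 x \in W) = (x \in W)) ->
  ~~ odd #|[set x in W | (x \in S) && (flip2 x \notin S)]|.
Proof.
move=> S1 W1 W2; set B := [set x in W | _].
have evSW : ~~ odd #|W :&: S|.
  apply: (even_involution (@flip1K D) (@flip1_neq D)) => x.
  by rewrite !inE W1 S1.
have evSWD : ~~ odd #|(W :&: S) :\: B|.
  apply: (even_involution (@flip2K D) (@flip2_neq D)) => x.
  rewrite !inE W2 flip2K => /andP[nB /andP[xW xS]]; move: nB.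
  by rewrite xW xS /= negbK => ->.
have sB : B \subset W :&: S.
  by apply/subsetP=> x; rewrite !inE => /and3P[-> ->].
by move: evSW; rewrite -(cardsID B (W :&: S)) (setIidPr sB) oddD;
  case: (odd #|B|) evSWD => // /negPf ->.
Qed.

Definition add_edge K x := [set x; flip0 x; flip2 x; flip0 (flip2 x)] :|: K.

Lemma add_edge_closed K x : edge_closed K -> edge_closed (add_edge K x).
Proof.
move=> clK y; have [K0 K2] := clK y; rewrite !inE K0 K2.
have E0 z : (flip0 y == z) = (y == flip0 z).
  by rewrite eq_sym (involutive_eq _ _ (@flip0K D)).
have E2 z : (flip2 y == z) = (y == flip2 z).
  by rewrite eq_sym (involutive_eq _ _ (@flip2K D)).
rewrite !E0 !E2 !flip0K !flip2K -!flip02C !flip2K.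
by split; do 4![case: (y == _)].
Qed.

Lemma card_add_edge K x : edge_closed K -> x \notin K ->
  #|add_edge K x| = #|K| + 4.
Proof.
move=> clK xK; rewrite cardsU addnC.
have -> : #|[set x; flip0 x; flip2 x; flip0 (flip2 x)] :&: K| = 0.
  apply/eqP; rewrite cards_eq0; apply/eqP/setP=> y; rewrite !inE.
  by apply/negP=> /andP[] /orP[/orP[/orP[]|]|] /eqP ->;
    rewrite ?(clK _).1 ?(clK _).2 ?(negPf xK).
rewrite subn0; congr (_ + _).
have n1 : flip0 x != flip2 x by apply: flip02_neq.
have n2 : x != flip0 (flip2 x).
  by apply: contra n1 => /eqP {1}->; rewrite flip0K.
have n3 : flip0 x != flip0 (flip2 x).
  by rewrite (inj_eq (can_inj (@flip0K D))) eq_sym flip2_neq.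
have n4 : flip2 x != flip0 (flip2 x) by rewrite eq_sym flip0_neq.
by rewrite -!setUA !cardsU1 cards1 !inE
  !negb_or n1 n2 n3 n4 !(eq_sym x (flip0 x)) (eq_sym x (flip2 x))
  flip0_neq flip2_neq.
Qed.

(* If the two sides of the edge of [x] lay in different regions, the boundary
   of one of them would meet the component of [x] in an odd number of flags:
   this edge has just one end there. *)
Lemma cut_edge K x : edge_closed K -> x \notin K ->
  ~~ connect (component_rel K) x (flip0 x) ->
  connect (region_rel (add_edge K x)) x (flip2 x).
Proof.
move=> clK xK ncx; set K' := add_edge K x.
have clK' : edge_closed K' by apply: add_edge_closed.
have symC := component_rel_sym clK; have symR := region_rel_sym clK'.
apply/idPn=> nrx.
pose S := [set y | connect (region_rel K') x y].
pose W := [set y | connect (component_rel K) x y].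
have step (e : rel D) y z : connect_sym e -> e y z -> connect e x z = connect e x y.
  by move=> sym_e yz; apply/esym/(same_connect_r sym_e)/connect1.
have S0 y : (flip0 y \in S) = (y \in S).
  by rewrite !inE; apply: step; rewrite // /component_rel /region_rel /= eqxx.
have S1 y : (flip1 y \in S) = (y \in S).
  by rewrite !inE; apply: step; rewrite // /component_rel /region_rel /= eqxx orbT.
have S2 y : y \notin K' -> (flip2 y \in S) = (y \in S).
  by move=> yK; rewrite !inE; apply: step; rewrite // /component_rel /region_rel /= yK eqxx !orbT.
have W1 y : (flip1 y \in W) = (y \in W).
  by rewrite !inE; apply: step; rewrite // /component_rel /region_rel /= eqxx.
have W2 y : (flip2 y \in W) = (y \in W).
  by rewrite !inE; apply: step; rewrite // /component_rel /region_rel /= eqxx orbT.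
have W0 y : y \in K -> (flip0 y \in W) = (y \in W).
  by move=> yK; rewrite !inE; apply: step; rewrite // /component_rel /region_rel /= yK eqxx !orbT.
have xS : x \in S by rewrite inE connect0.
have xW : x \in W by rewrite inE connect0.
have x2S : flip2 x \notin S by rewrite inE.
have x0W : flip0 x \notin W by rewrite inE.
(* Generalizing keeps [inE] from unfolding [S] and [W] below. *)
move: S W S0 S1 S2 W0 W1 W2 xS xW x2S x0W => S W S0 S1 S2 W0 W1 W2 xS xW x2S x0W.
have := even_boundary S1 W1 W2; set B := [set y in W | _] => /negP[].
have xB : x \in B by rewrite inE xW xS x2S.
rewrite (cardsD1 x) xB /=.
(* Without [x] the boundary flags in [W] are paired by [flip0]: edges of [K] keep both ends in [W],
   and of the new edge only [x] itself was counted. *)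
apply: (even_involution (@flip0K D) (@flip0_neq D)) => y.
rewrite !inE => /andP[yx /and3P[yW yS y2S]].
have yK' : y \in K' by apply/idPn=> /S2; rewrite yS (negPf y2S).
have yK : y \in K.
  have := yK'; rewrite !inE => /orP[/orP[/orP[/orP[]|]|]|//] /eqP eq_y.
  - by rewrite eq_y eqxx in yx.
  - by rewrite eq_y (negPf x0W) in yW.
  - by rewrite eq_y (negPf x2S) in yS.
  - by rewrite eq_y S0 (negPf x2S) in yS.
have := W0 _ yK; have := S0 y; have := S0 (flip2 y).
rewrite flip02C yS yW (negPf y2S) => -> -> ->; rewrite andbT.
apply/eqP=> eq_x; move: x0W; rewrite -eq_x flip0K.
by rewrite yW.
Qed.

End EdgeSubsets.

(** The links from [a] to the members of [s] are added one by one, each costing at most one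
    component. *)
Lemma leq_n_comp_glue (T : finType) (e : rel T) (a : T) (s : seq T) :
  symmetric e ->
  n_comp e predT <= n_comp [rel x y | [|| e x y, (x == a) && (y \in s)
                                        | (y == a) && (x \in s)]] predT + size s.
Proof.
move=> sym_e; pose g (s : seq T) : rel T := [rel x y | [|| e x y, (x == a) && (y \in s)
                                        | (y == a) && (x \in s)]].
have sym_g s' : connect_sym (g s').
  by apply: sym_connect_sym => x y; rewrite /g /= sym_e; congr orb; rewrite orbC.
elim: s => [|b s IH].
  rewrite addn0; apply: (leq_n_comp (sym_g _) (sym_connect_sym sym_e)) => x y.
  by rewrite /g /= !in_nil !andbF !orbF; apply: connect1.
apply: leq_trans IH _; rewrite /= addnS -addSn leq_add2r.
apply: (leq_n_comp_add (a := a) (b := b) (sym_g s) (sym_g (b :: s))) => x y.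
rewrite /g /= !inE => /or3P[exy|/andP[/eqP-> /orP[/eqP->|ys]]|/andP[/eqP-> /orP[/eqP->|xs]]].
- by rewrite connect1 // /g /= exy.
- by rewrite !connect0 orbT.
- by rewrite connect1 // /g /= eqxx ys orbT.
- by rewrite !connect0 !orbT.
- by rewrite connect1 // /g /= eqxx xs !orbT.
Qed.

Section EulerInequality.
Variable D : cell_decomposition.
Implicit Types (x y z : D) (K S W : {set D}).

Lemma card_flag_leq : #|D| <= 4 * nb_edges D.
Proof.
pose e := flip_rel (@flip0 D) (@flip2 D).
have sym_e : connect_sym e := flip_rel_sym (@flip0K D) (@flip2K D).
rewrite /nb_edges n_comp_predT -/e; set R := [set x | roots e x].
have -> : #|D| = \sum_(x : D) 1 by rewrite sum1_card.
rewrite (partition_big (fingraph.root e) (mem R)); last first.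
  by move=> x _; rewrite !inE; apply: (fingraph.roots_root sym_e).
have -> : 4 * #|R| = \sum_(r in R) 4.
  by rewrite sum_nat_const mulnC.
apply: leq_sum => r _; rewrite sum1_card.
apply: leq_trans (_ : #|[set r; flip0 r; flip2 r; flip0 (flip2 r)]| <= 4); last first.
  by rewrite -!setUA !cardsU1 cards1; do 3![case: (_ \in _)].
apply/subset_leq_card/subsetP=> x; rewrite inE => /eqP root_x.
have: connect e r x by rewrite sym_e -root_x connect_root.
case/connectP=> p; elim/last_ind: p x {root_x} => [|p y IH] x.
  by move=> _ ->; rewrite !inE eqxx.
rewrite rcons_path last_rcons => /andP[rp py] ->.
have := IH _ rp erefl; move: py; rewrite /e /flip_rel /= !inE.
move=> /orP[]/eqP-> /orP[/orP[/orP[]|]|] /eqP->;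
  by rewrite ?flip0K -?flip02C ?flip0K ?flip2K ?eqxx ?orbT.
Qed.

(** Euler's inequality for a spanning subgraph, an edge counting as four flags. Induction on the
    edges outside [K]: if there are none, one component is left and the regions are the faces.
    Adding an edge either keeps the components and makes at most one more region, or merges two
    components and, by [cut_edge], makes no further region. *)
Lemma region_count_add K : edge_closed K ->
  #|K| + 4 * n_comp (component_rel K) predT + 4 * nb_faces D
    <= #|D| + 4 + 4 * n_comp (region_rel K) predT.
Proof.
have [n] := ubnP #|~: K|; elim: n K => // n IH K leKn clK.
have symC := component_rel_sym clK; have symR := region_rel_sym clK.
have [K_full|[x]] := set_0Vmem (~: K).
  have {}K_full x : x \in K.
    by apply/negPn; rewrite -in_setC K_full inE.
  have leF : nb_faces D <= n_comp (region_rel K) predT.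
    apply: leq_n_comp symR (flip_rel_sym (@flip0K D) (@flip1K D)) _ => x y.
    rewrite /region_rel /= K_full orbF => xy; apply: connect1.
    by rewrite /flip_rel /= !inE.
  have leC : n_comp (component_rel K) predT <= 1.
    have [x _] : exists x : D, x \in predT.
      by apply/card_gt0P; exact: flag_nonempty.
    rewrite -(n_comp_connect symC x) (eq_leq (eq_n_comp_r _)) // => y.
    rewrite !inE; apply/esym.
    have := flag_connected x y; apply: connect_sub => u v /=.
    rewrite /component_rel !inE => uv; apply: connect1 => /=.
    by rewrite K_full orbC -orbA /=; case/or3P: uv => ->; rewrite ?orbT.
  have leK : #|K| <= #|D| by apply: max_card.
  lia.
rewrite inE => xK.
have clK' := add_edge_closed x clK; have cardK' := card_add_edge clK xK.
set K' := add_edge K x in clK' cardK'.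
have symC' := component_rel_sym clK'; have symR' := region_rel_sym clK'.
have ltK'n : #|~: K'| < n by have := cardsC K; have := cardsC K'; lia.
have := IH K' ltK'n clK'; rewrite cardK' => IHK'.
have subKK' y : y \in K -> y \in K' by rewrite !inE => ->; rewrite orbT.
have K'_orbit y : y \in K' -> y \notin K ->
    y \in [:: x; flip0 x; flip2 x; flip0 (flip2 x)].
  by rewrite !inE -!orbA => /or4P[->|->|->|/orP[->|->]]; rewrite ?orbT.
have incR y z : region_rel K' y z -> connect (region_rel K) y z.
  rewrite /region_rel /= => yz; apply: connect1 => /=.
  by move: yz => /or3P[->|->|/andP[/(contra (@subKK' y)) /= -> ->]];
    rewrite ?orbT.
have leR : n_comp (region_rel K') predT <= (n_comp (region_rel K) predT).+1.
  apply: (leq_n_comp_add (a := x) (b := flip2 x) symR' symR) => y z.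
  have R0 u : connect (region_rel K') u (flip0 u).
    by apply: connect1; rewrite /region_rel /= eqxx.
  have R0' u : connect (region_rel K') (flip0 u) u by rewrite symR'.
  rewrite {1}/region_rel /= => /or3P[/eqP->|/eqP->|/andP[yK /eqP->]].
  - by rewrite R0.
  - by rewrite (@connect1 _ _ y (flip1 y)) // /region_rel /= eqxx orbT.
  have [/K'_orbit/(_ yK)|yK'] := boolP (y \in K'); last first.
    by rewrite (@connect1 _ _ y (flip2 y)) // /region_rel /= yK' eqxx !orbT.
  rewrite !inE => /or4P[] /eqP->; rewrite -?flip02C ?flip2K ?connect0 ?orbT //;
    by rewrite ?R0 ?R0' ?orbT.
have leC : n_comp (component_rel K) predT <= (n_comp (component_rel K') predT).+1.
  apply: (leq_n_comp_add (a := x) (b := flip0 x) symC symC') => y z.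
  have C2 u : connect (component_rel K) u (flip2 u).
    by apply: connect1; rewrite /component_rel /= eqxx orbT.
  have C2' u : connect (component_rel K) (flip2 u) u by rewrite symC.
  rewrite {1}/component_rel /= => /or3P[/eqP->|/eqP->|/andP[yK' /eqP->]].
  - by rewrite (@connect1 _ _ y (flip1 y)) // /component_rel /= eqxx.
  - by rewrite C2.
  have [yK|/(K'_orbit _ yK')] := boolP (y \in K).
    by rewrite (@connect1 _ _ y (flip0 y)) // /component_rel /= yK eqxx !orbT.
  rewrite !inE => /or4P[] /eqP->; rewrite ?flip0K ?connect0 ?orbT //;
    by rewrite ?flip02C ?C2 ?C2' ?orbT.
have [conn_x|ncx] := boolP (connect (component_rel K) x (flip0 x)).
  suff: n_comp (component_rel K) predT <= n_comp (component_rel K') predT by lia.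
  apply: (leq_n_comp symC' symC) => y z.
  have C2 u : connect (component_rel K) u (flip2 u).
    by apply: connect1; rewrite /component_rel /= eqxx orbT.
  have C2' u : connect (component_rel K) (flip2 u) u by rewrite symC.
  rewrite {1}/component_rel /= => /or3P[/eqP->|/eqP->|/andP[yK' /eqP->]] //.
  - by rewrite (@connect1 _ _ y (flip1 y)) // /component_rel /= eqxx.
  have [yK|/(K'_orbit _ yK')] := boolP (y \in K).
    by rewrite (@connect1 _ _ y (flip0 y)) // /component_rel /= yK eqxx !orbT.
  have C22 : connect (component_rel K) (flip2 x) (flip2 (flip0 x)).
    exact: connect_trans (C2' x) (connect_trans conn_x (C2 _)).
  rewrite !inE => /or4P[] /eqP->; rewrite ?flip0K ?connect0 ?orbT //.
  - by rewrite symC.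
  - by rewrite flip02C.
  - by rewrite symC flip02C.
suff: n_comp (region_rel K') predT <= n_comp (region_rel K) predT by lia.
have conn2 := cut_edge clK xK ncx; rewrite -/K' in conn2.
apply: (leq_n_comp symR symR') => y z.
have R0 u : connect (region_rel K') u (flip0 u).
  by apply: connect1; rewrite /region_rel /= eqxx.
have R0' u : connect (region_rel K') (flip0 u) u by rewrite symR'.
rewrite {1}/region_rel /= => /or3P[/eqP->|/eqP->|/andP[yK /eqP->]] //.
- by rewrite (@connect1 _ _ y (flip1 y)) // /region_rel /= eqxx orbT.
have [/K'_orbit/(_ yK)|yK'] := boolP (y \in K'); last first.
  by rewrite (@connect1 _ _ y (flip2 y)) // /region_rel /= yK' eqxx !orbT.
have R22 : connect (region_rel K') (flip0 x) (flip0 (flip2 x)).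
  exact: connect_trans (R0' x) (connect_trans conn2 (R0 _)).
rewrite !inE => /or4P[] /eqP->; rewrite -?flip02C ?flip2K // symR' //.
Qed.

(** All ends of edges of [K] are vertices of [A], so gluing these together by [#|A|.-1] links makes
    up for all of [K]: [D] has at most [#|A|.-1] more vertices than the subgraph has components. As
    the Euler characteristic is nonnegative, the preceding inequality becomes four times e <= n +
    f. *)
Lemma region_count (I : finType) (h : I -> D) (A : {set I}) K :
  (0 <= euler_char D)%R -> A != set0 -> edge_closed K ->
  (forall x, x \in K -> exists2 u, u \in A & same_vertex (h u) x) ->
  #|K| <= 4 * #|A| + 4 * n_comp (region_rel K) predT.
Proof.
move=> chi_ge0 /set0Pn[a aA] clK KA.
pose e := flip_rel (@flip1 D) (@flip2 D).
have sym_e : symmetric e.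
  move=> x y; rewrite /e /flip_rel /= !inE.
  by rewrite (involutive_eq _ _ (@flip1K D)) (involutive_eq _ _ (@flip2K D)).
have leV : nb_vertices D <= n_comp (component_rel K) predT + #|A|.-1.
  have := leq_n_comp_glue (h a) [seq h u | u <- enum (A :\ a)] sym_e.
  rewrite size_map -cardE (_ : #|A :\ a| = #|A|.-1); last first.
    by rewrite (cardsD1 a A) aA.
  set g := [rel x y | _] => /leq_trans-> //; rewrite leq_add2r.
  have sym_g : connect_sym g.
    by apply: sym_connect_sym => x y; rewrite /g /= sym_e; congr orb; rewrite orbC.
  have eg x y : connect e x y -> connect g x y.
    by apply: connect_sub => u v uv; apply: connect1; rewrite /= uv.
  have Ag x y : x \in K -> same_vertex (h a) y -> connect g x y.
    move=> xK; rewrite /same_vertex -/e => /eg ay.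
    have [u uA /eg hux] := KA x xK.
    rewrite sym_g in hux; apply: connect_trans hux _.
    apply: connect_trans ay.
    have [->|ua] := eqVneq u a; first exact: connect0.
    have us : h u \in [seq h w | w <- enum (A :\ a)].
      by apply: map_f; rewrite mem_enum !inE ua.
    by apply: connect1; rewrite /= eqxx us !orbT.
  apply: (leq_n_comp (component_rel_sym clK) sym_g) => x y.
  rewrite /component_rel /= => /or3P[/eqP->|/eqP->|/andP[xK /eqP->]].
  - by apply/eg/connect1; rewrite /e /flip_rel /= inE eqxx.
  - by apply/eg/connect1; rewrite /e /flip_rel /= !inE eqxx orbT.
  apply: connect_trans (_ : connect g (h a) _).
    by apply: Ag => //; apply: connect0.
  by rewrite sym_g; apply: Ag; rewrite ?(clK _).1 //; apply: connect0.
have A_gt0 : 0 < #|A| by rewrite (cardsD1 a) aA.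
have := region_count_add clK; have := card_flag_leq.
rewrite /euler_char in chi_ge0; lia.
Qed.

End EulerInequality.

(** * Drawings of induced subgraphs, without reference to flags *)

Definition nbrs (G : sgraph) (A : {set G}) (v : G) : {set G} :=
  [set w in A | adj v w].

(** Every edge occurs four times, once for each end and side, so [region_euler] below is four times
    e <= n + f. *)
Definition sides (G : sgraph) (A : {set G}) : {set G * G * bool} :=
  [set p | (p.1.1 \in A) && (p.1.2 \in nbrs A p.1.1)].

(* What discharging needs to know about a drawing of the subgraph induced by
   [A]. Each edge [uv] has two sides, [(u, v, true)] and [(u, v, false)], and
   [region u v b] is the component of the complement of the drawing on that
   side. *)
Record drawing (G : sgraph) (A : {set G}) := Drawing {
  regions : finType;
  region : G -> G -> bool -> regions;
  region_sym : forall u v b, u \in A -> v \in nbrs A u ->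
    region v u b = region u v b;
  region_even : forall (S : {set regions}) v, v \in A ->
    ~~ odd #|[set w in nbrs A v |
               (region v w true \in S) (+) (region v w false \in S)]|;
  region_closed : forall (S : {set regions}) v, v \in A ->
    (forall w, w \in nbrs A v ->
       (region v w true \in S) = (region v w false \in S)) ->
    forall w w' b b', w \in nbrs A v -> w' \in nbrs A v ->
      region v w b \in S -> region v w' b' \in S;
  region_euler : #|sides A| <=
    4 * #|A| + 4 * #|[set region p.1.1 p.1.2 p.2 | p in sides A]| }.

(** The sides of an edge become the four flags of its image, and regions are named by the roots of
    [region_rel]. Parity and closedness at a vertex come from the flags around its image. The edge
    from [u0] to [v0] ensures that every region has a side. *)
Lemma embeddable_drawing (G : sgraph) (S : nonneg_surface) (A : {set G}) u0 v0 :
  embeddable G S -> u0 \in A -> v0 \in nbrs A u0 -> inhabited (drawing A).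
Proof.
move=> [D [h [decD h_inj h_edge]]] u0A v0u0.
have chi_ge0 : (0 <= euler_char D)%R by case: decD => -> _; case: S.
have sv_sym := flip_rel_sym (@flip1K D) (@flip2K D).
have sv_step (x y z : D) : y \in [:: flip1 x; flip2 x] ->
    same_vertex z y = same_vertex z x.
  by move=> xy; apply/esym/(same_connect_r sv_sym)/connect1.
have sv1 (x z : D) : same_vertex z (flip1 x) = same_vertex z x.
  by apply: sv_step; rewrite !inE eqxx.
have sv2 (x z : D) : same_vertex z (flip2 x) = same_vertex z x.
  by apply: sv_step; rewrite !inE eqxx orbT.
have sv_inj u v x : same_vertex (h u) x -> same_vertex (h v) x -> u = v.
  move=> ux; rewrite /same_vertex sv_sym => xv; apply: h_inj.
  exact: connect_trans ux xv.
pose P u v := [pred x | same_vertex (h u) x && same_vertex (h v) (flip0 x)].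
pose s0 u v := odflt (h u) [pick x | P u v x].
(* The end of lower rank chooses the flag, so that [s u v] and [s v u] belong to the same edge of
   [D] and differ by [flip0]. *)
pose s u v := if enum_rank u < enum_rank v then s0 u v else flip0 (s0 v u).
have s0P u v : adj u v -> P u v (s0 u v).
  move=> /h_edge[x [ux vx]]; rewrite /s0; case: pickP => [//|/(_ x)].
  by rewrite /= ux vx.
have sP u v : adj u v -> P u v (s u v).
  move=> uv; rewrite /s; case: ifP => _; first exact: s0P.
  by rewrite /= flip0K andbC; apply: s0P; rewrite adj_sym.
have sC u v : adj u v -> s v u = flip0 (s u v).
  move=> uv; rewrite /s.
  case: (ltngtP (enum_rank u) (enum_rank v)) => [||/ord_inj/enum_rank_inj eq_uv].
  - by [].
  - by rewrite flip0K.
  - by rewrite eq_uv adj_irr in uv.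
pose kf (p : G * G * bool) :=
  if p.2 then flip2 (s p.1.1 p.1.2) else s p.1.1 p.1.2.
have kf0 u v b : adj u v -> flip0 (kf (u, v, b)) = kf (v, u, b).
  by move=> uv; rewrite /kf /= (sC _ _ uv) -flip02C; case: b.
have kf2 u v b : flip2 (kf (u, v, b)) = kf (u, v, ~~ b).
  by rewrite /kf /=; case: b; rewrite /= ?flip2K.
have kfP u v b : adj u v -> same_vertex (h u) (kf (u, v, b)).
  by move=> /sP/andP[us _]; rewrite /kf /=; case: b; rewrite ?sv2.
have kf_inj : {in sides A &, injective kf}.
  move=> [[u v] b] [[u' v'] b'] /=; rewrite !inE /=.
  move=> /and3P[_ _ uv] /and3P[_ _ uv'] eq_kf.
  have eq_u : u = u' by apply: sv_inj (kfP u v b uv) _; rewrite eq_kf kfP.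
  have eq_v : v = v'.
    have vu : adj v u by rewrite adj_sym.
    have vu' : adj v' u' by rewrite adj_sym.
    apply: sv_inj (kfP v u b vu) _; rewrite -kf0 // eq_kf kf0 //.
    exact: kfP.
  subst u' v'; congr (_, _, _); move: eq_kf; rewrite /kf /=.
  case: b; case: b' => // /eqP; first by rewrite (negPf (flip2_neq _)).
  by rewrite eq_sym (negPf (flip2_neq _)).
pose K := kf @: sides A.
have sidesE u v b : ((u, v, b) \in sides A) = (u \in A) && (v \in nbrs A u).
  by rewrite inE.
have sidesC u v b : u \in A -> v \in nbrs A u -> (v, u, b) \in sides A.
  by rewrite !inE /= => -> /andP[-> uv]; rewrite adj_sym.
have KP x : reflect (exists u v b, [/\ u \in A, v \in nbrs A u & x = kf (u, v, b)])
                    (x \in K).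
  apply: (iffP imsetP) => [[[[u v] b]]|[u [v [b [uA vu ->]]]]].
    by rewrite sidesE => /andP[uA vu] ->; exists u, v, b.
  by exists (u, v, b); rewrite // sidesE uA.
have nbrs_adj u v : v \in nbrs A u -> adj u v by rewrite inE => /andP[].
have clK : edge_closed K.
  have K0 x : x \in K -> flip0 x \in K.
    move=> /KP[u [v [b [uA vu ->]]]]; rewrite kf0 ?nbrs_adj //.
    by apply: imset_f; apply: sidesC.
  have K2 x : x \in K -> flip2 x \in K.
    move=> /KP[u [v [b [uA vu ->]]]]; rewrite kf2.
    by apply: imset_f; rewrite sidesE uA.
  move=> x; split; apply/idP/idP=> xK; try by [apply: K0 | apply: K2].
    by rewrite -(flip0K x) K0.
  by rewrite -(flip2K x) K2.
have symR := region_rel_sym clK.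
pose rt (x : D) : D := fingraph.root (region_rel K) x.
have rt_step (x y : D) : region_rel K x y -> rt y = rt x.
  by move=> xy; apply/esym/(fingraph.rootP symR)/connect1.
have rt0 x : rt (flip0 x) = rt x.
  by apply: rt_step; rewrite /region_rel /= eqxx.
have rt1 x : rt (flip1 x) = rt x.
  by apply: rt_step; rewrite /region_rel /= eqxx orbT.
have rt2 x : x \notin K -> rt (flip2 x) = rt x.
  by move=> xK; apply: rt_step; rewrite /region_rel /= xK eqxx !orbT.
pose reg u v b := rt (kf (u, v, b)).
pose bd (R : {set D}) v := [set w in nbrs A v | (reg v w true \in R) (+) (reg v w false \in R)].
pose B (R : {set D}) v :=
  [set x in [set x | same_vertex (h v) x] |
    (x \in [set x | rt x \in R]) && (flip2 x \notin [set x | rt x \in R])].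
have KatP v x : x \in K -> same_vertex (h v) x ->
    exists w b, [/\ v \in A, w \in nbrs A v & x = kf (v, w, b)].
  move=> /KP[u [w [b [uA wu ->]]]] vx.
  have eq_uv : u = v by apply: sv_inj vx; rewrite kfP ?nbrs_adj.
  by subst v; exists w, b.
(* An edge on the boundary of [R] has exactly one of its two flags at [v] inside, and these are the
   flags counted by [even_boundary]. *)
have card_bd R v : v \in A -> #|bd R v| = #|B R v|.
  move=> vA; pose f w := kf (v, w, reg v w true \in R).
  have kfE w b : rt (kf (v, w, b)) = reg v w b by [].
  have f_sides w : w \in bd R v -> (v, w, reg v w true \in R) \in sides A.
    by rewrite inE sidesE vA => /andP[].
  rewrite -(card_in_imset (f := f) (D := bd R v)); last first.
    by move=> w w' /f_sides wS /f_sides w'S /(kf_inj _ _ wS w'S)[].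
  apply: eq_card => x; apply/imsetP/idP=> [[w]|].
    rewrite !inE -/(reg _ _ _) => /andP[/andP[wA vw] bw] ->.
    rewrite /f kf2 kfP //= !kfE; move: bw.
    by case E: (reg v w true \in R); rewrite /= E => ->.
  rewrite !inE => /and3P[vx xR x2R].
  have xK : x \in K by apply: contraNT x2R => /rt2 ->.
  have [w [b [_ wv def_x]]] := KatP _ _ xK vx.
  move: xR x2R; rewrite def_x kf2 !kfE => xR x2R.
  have eq_b : b = (reg v w true \in R).
    by case: b {def_x} xR x2R => /= [->|_ /negPf ->].
  exists w; last by rewrite /f -eq_b.
  rewrite inE wv /=; case: b {def_x eq_b} xR x2R => /= [-> /negPf ->|-> /negPf ->] //.
constructor; exists D reg.
- by move=> u v b uA vu; rewrite /reg -kf0 ?nbrs_adj // rt0.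
- move=> R v vA; rewrite -/(bd R v) card_bd //; apply: even_boundary => x.
  + by rewrite !inE rt1.
  + by rewrite !inE sv1.
  + by rewrite !inE sv2.
- move=> R v vA eqR w w' b b' wv w'v wR.
  have closed1 x : same_vertex (h v) x -> rt x \in R -> rt (flip2 x) \in R.
    move=> vx xR; have [xK|xK] := boolP (x \in K); last by rewrite rt2.
    have [z [c [_ zv def_x]]] := KatP _ _ xK vx.
    move: xR; rewrite def_x kf2; have := eqR z zv; rewrite /reg.
    by case: c {def_x} => /= ->.
  have vw : adj v w by apply: nbrs_adj.
  have vw' : adj v w' by apply: nbrs_adj.
  have : same_vertex (kf (v, w, b)) (kf (v, w', b')).
    have := kfP v w b vw; rewrite /same_vertex sv_sym => kv.
    exact: connect_trans kv (kfP _ _ _ vw').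
  case/connectP=> p path_p last_p; move: (kfP v w b vw) wR.
  rewrite /reg last_p; move: path_p {last_p}.
  elim: p (kf (v, w, b)) => //= x p IH y /andP[yx path_p] vy yR.
  apply: IH => //.
    by rewrite (sv_step y).
  move: yx; rewrite /flip_rel /= !inE => /orP[] /eqP->; first by rewrite rt1.
  exact: closed1.
- have A0 : A != set0 by apply/set0Pn; exists u0.
  have KA x : x \in K -> exists2 u, u \in A & same_vertex (h u) x.
    by move=> /KP[u [v [b [uA vu ->]]]]; exists u; rewrite ?kfP ?nbrs_adj.
  have := region_count chi_ge0 A0 clK KA; rewrite card_in_imset //.
  move/leq_trans; apply; rewrite leq_add2l leq_mul2l /= n_comp_predT.
  apply/subset_leq_card/subsetP=> r; rewrite inE => /eqP root_r.
  (* Every region meets [K]: on a path from [r] to a flag of [K], all steps before the first flag in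
     [K] stay in the region. *)
  suff [y yK ry] : exists2 y, y \in K & connect (region_rel K) r y.
    have [u [v [b [uA vu def_y]]]] := KP _ yK.
    apply/imsetP; exists (u, v, b); first by rewrite sidesE uA.
    rewrite /= /reg -def_y -[LHS]root_r; exact/(fingraph.rootP symR).
  have k0K : kf (u0, v0, true) \in K by apply: imset_f; rewrite sidesE u0A.
  case/connectP: (flag_connected r (kf (u0, v0, true))) => p path_p last_p.
  have {p path_p last_p} : exists p x, [/\ connect (region_rel K) r x,
      path [rel u v | v \in [:: flip0 u; flip1 u; flip2 u]] x p
      & last x p \in K].
    by exists p, r; rewrite connect0 path_p -last_p.
  case=> p; elim: p => [|y p IH] [x [rx /= ]].
    by move=> _ xK; exists x.
  move=> /andP[xy path_p] last_p.
  have [xK|xK] := boolP (x \in K); first by exists x.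
  apply: IH; exists y; split=> //; apply: connect_trans rx _; apply: connect1.
  by move: xy; rewrite /region_rel /= !inE xK.
Qed.

(** * Colorings of degenerate graphs *)

Lemma exists_least (P : nat -> Prop) k : P k -> exists m, is_least P m /\ m <= k.
Proof.
have [n] := ubnP k; elim: n k => // n IH k ltkn Pk.
have [[m [Pm ltmk]]|no_less] := classic (exists m, P m /\ m < k).
  have [|m' [least_m' lem']] := IH m _ Pm; first lia.
  by exists m'; split=> //; lia.
exists k; split=> //; split=> // m Pm; rewrite leqNgt; apply/negP=> ltmk.
by apply: no_less; exists m.
Qed.

Section Degenerate.
Variables (G : sgraph) (r : G -> nat) (k : nat).

Definition back (v : G) : {set G} := [set u | adj u v && (r u < r v)].

Hypothesis r_inj : injective r.
Hypothesis back_leq : forall v, #|back v| <= k.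

Lemma back_or_back u v : adj u v -> u \in back v \/ v \in back u.
Proof.
move=> uv; rewrite !inE uv adj_sym uv /=; case: ltngtP; [by left|by right|].
by move/r_inj=> eq_uv; rewrite eq_uv adj_irr in uv.
Qed.

(** The conflicts [cf] are equality for list coloring and the given matchings for DP-coloring;
    either way an earlier neighbor forbids at most one color. *)
Lemma greedy_coloring (C : finType) (L : G -> {set C}) (cf : G -> G -> rel C) :
  (forall v, k < #|L v|) ->
  (forall u v a b b', adj u v -> cf u v a b -> cf u v a b' -> b = b') ->
  exists phi : G -> C, (forall v, phi v \in L v) /\
    (forall u v, u \in back v -> ~~ cf u v (phi u) (phi v)).
Proof.
move=> L_gt cf_inj.
suff H n : exists phi : G -> C, (forall v, phi v \in L v) /\
    (forall u v, r v < n -> u \in back v -> ~~ cf u v (phi u) (phi v)).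
  have [phi [phiL phi_cf]] := H (\max_v r v).+1; exists phi; split=> // u v.
  by apply: phi_cf; rewrite ltnS; apply: leq_bigmax.
elim: n => [|n [phi [phiL phi_cf]]].
  have: forall v, exists c, c \in L v.
    by move=> v; apply/set0Pn; rewrite -card_gt0; apply: leq_trans (L_gt v).
  by case/fin_all_exists=> phi phiL; exists phi.
have: forall v, exists c, c \in L v /\
    if r v == n then [forall u in back v, ~~ cf u v (phi u) c] else c == phi v.
  move=> v; case: eqP => _; last by exists (phi v).
  pose F := [set c in L v | [exists u in back v, cf u v (phi u) c]].
  have [c] : exists c, c \in L v :\: F.
    apply/set0Pn; rewrite -card_gt0 cardsD subn_gt0.
    apply: leq_trans (L_gt v); rewrite ltnS; apply: leq_trans (back_leq v).
    apply: leq_trans (subset_leq_card (subsetIr _ _)) _.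
    (* The color that [u] forbids; the default for a [u] forbidding none only enlarges the image. *)
    pose f u := odflt (phi v) [pick c | cf u v (phi u) c].
    apply: leq_trans (leq_imset_card f (back v)).
    apply/subset_leq_card/subsetP=> c; rewrite inE => /andP[_ /exists_inP[u uv cfc]].
    apply/imsetP; exists u => //; rewrite /f; case: pickP => [c' cfc'|/(_ c)].
      by apply: cf_inj cfc cfc'; move: uv; rewrite inE => /andP[].
    by rewrite cfc.
  rewrite !inE => /andP[+ cL]; rewrite cL /= => c_ok; exists c; split=> //.
  by apply/forall_inP=> u uv; apply: contra c_ok => cfc; apply/exists_inP; exists u.
case/fin_all_exists=> phi' phi'P; exists phi'; split=> [v|u v].
  by have [] := phi'P v.
rewrite ltnS => le_vn uv; have ltuv : r u < r v by move: uv; rewrite inE => /andP[].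
have [_] := phi'P u; rewrite ltn_eqF; last exact: leq_trans le_vn.
move/eqP->; have [_] := phi'P v; case: (ltngtP (r v) n) le_vn => // [ltvn|eqvn] _.
  by move/eqP->; apply: phi_cf.
by move/forall_inP; apply.
Qed.

Lemma degenerate_choosable : choosable G k.+1.
Proof.
move=> C L cardL.
have [||phi [phiL phi_cf]] :=
  @greedy_coloring C L (fun u v a b => a == b).
- by move=> v; rewrite cardL.
- by move=> u v a b b' _ /eqP<- /eqP.
exists phi; split=> // u v /back_or_back[/phi_cf //|/phi_cf].
by rewrite eq_sym.
Qed.

Lemma degenerate_DP_colorable : DP_colorable G k.+1.
Proof.
move=> M coverM.
have [||phi [_ phi_cf]] := @greedy_coloring 'I_k.+1 (fun=> setT) M.
- by move=> v; rewrite cardsT card_ord.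
- by move=> u v a b b' uv; have [_ H _] := coverM _ _ uv; apply: H.
exists phi => u v uv; have [symM _ _] := coverM _ _ uv.
by case: (back_or_back uv) => /phi_cf //; rewrite symM.
Qed.

(** Greedy choice: take the vertex of [S] lowest in [r], discard its neighbors, repeat. A discarded
    vertex has an earlier neighbor that was taken. This is Painter's reply. *)
Lemma exists_kernel (S : {set G}) : exists I : {set G},
  [/\ I \subset S, independent I
    & forall v, v \in S -> v \notin I -> exists2 u, u \in I & u \in back v].
Proof.
have [n] := ubnP #|S|; elim: n S => // n IH S leSn.
have [->|[v0 v0S]] := set_0Vmem S.
  exists set0; split=> //; last by move=> v; rewrite inE.
  by apply/forall_inP=> v; rewrite inE.
case: (arg_minnP r v0S) => v v_in v_min; have vS : v \in S by [].
pose S' := [set w in S :\ v | ~~ adj v w].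
have [|I [subI indI domI]] := IH S'.
  rewrite ltnS in leSn; apply: leq_trans leSn; rewrite [leqRHS](cardsD1 v) vS.
  by rewrite ltnS; apply/subset_leq_card/subsetP=> w; rewrite inE => /andP[].
exists (v |: I); split.
- apply/subsetP=> w; rewrite !inE => /orP[/eqP->//|/(subsetP subI)].
  by rewrite !inE => /andP[/andP[]].
- have vI w : w \in I -> ~~ adj v w.
    by move/(subsetP subI); rewrite inE => /andP[].
  apply/forall_inP=> u; rewrite !inE => uI; apply/forall_inP=> w; rewrite !inE => wI.
  case/orP: uI => [/eqP->|uI]; case/orP: wI => [/eqP->|wI].
  + by rewrite adj_irr.
  + exact: vI.
  + by rewrite adj_sym vI.
  + by move/forall_inP: indI => /(_ u uI)/forall_inP/(_ w wI).
- move=> w wS; rewrite !inE negb_or => /andP[wv wI].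
  have [vw|nvw] := boolP (adj v w); last first.
    have [|u uI uw] := domI w _ wI; first by rewrite !inE wv wS.
    by exists u => //; rewrite !inE uI orbT.
  exists v; rewrite !inE ?eqxx // vw ltn_neqAle v_min // andbT.
  by apply: contra wv => /eqP/r_inj->.
Qed.

(* Painter colors greedily, so a vertex that loses a token and stays uncolored
   loses a neighbor from [back]. *)
Lemma degenerate_painter_wins (U : {set G}) (t : G -> nat) :
  (forall v, v \in U -> #|back v :&: U| < t v) -> painter_wins U t.
Proof.
have [answer answerP] := fin_all_exists exists_kernel.
have [n] := ubnP #|U|; elim: n U t => // n IH U t leUn tU.
apply: (@PainterRound _ _ _ answer) => [v vU|S _ _|S _ _|S S0 SU].
- exact: leq_trans (tU v vU).
- by have [] := answerP S.
- by have [] := answerP S.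
have [sub_aS _ dom] := answerP S.
have [x xS] : exists x, x \in answer S.
  have [v vS] := set0Pn _ S0; have [|va] := boolP (v \in answer S); first by exists v.
  by have [u] := dom v vS va; exists u.
apply: IH => [|v].
  rewrite ltnS in leUn; apply: leq_trans leUn; apply: proper_card.
  rewrite properE subsetDl; apply/subsetPn; exists x.
    by apply: (subsetP SU); apply: (subsetP sub_aS).
  by rewrite inE xS.
rewrite inE => /andP[va vU]; have := tU v vU.
have subB : back v :&: (U :\: answer S) \subset back v :&: U.
  by apply: setIS; apply: subsetDl.
have [vS|_] := boolP (v \in S); last first.
  by rewrite subn0; apply: leq_ltn_trans (subset_leq_card subB).
have [u ua uv] := dom v vS va.
have uU : u \in U by apply: (subsetP SU); apply: (subsetP sub_aS).
suff: #|back v :&: (U :\: answer S)| < #|back v :&: U| by lia.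
apply: proper_card; rewrite properE subB; apply/subsetPn; exists u.
  by rewrite inE uv.
by rewrite !in_setI in_setD ua /= andbF.
Qed.

Lemma degenerate_paintable : paintable G k.+1.
Proof.
apply: degenerate_painter_wins => v _; rewrite ltnS.
by apply: leq_trans (back_leq v); apply: subset_leq_card; apply: subsetIl.
Qed.

(** Edges are directed to the earlier end. In a nonempty Eulerian subdigraph the latest tail would
    need an arc into it from a still later tail; so only the empty one exists, and the two counts
    are 1 and 0. *)
Lemma degenerate_AT_orientable : AT_orientable G k.+1.
Proof.
pose D := [set p : G * G | p.2 \in back p.1].
exists D; split.
- split=> u v; first by rewrite !inE adj_sym => /andP[].
  move=> uv; rewrite !inE adj_sym uv /=; case: ltngtP => // /r_inj eq_uv.
  by rewrite eq_uv adj_irr in uv.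
- move=> v; rewrite ltnS; apply: leq_trans (back_leq v).
  by apply/subset_leq_card/subsetP=> w; rewrite !inE.
have eulerD H : H \in eulerian_subs D -> H = set0.
  rewrite inE => /andP[/subsetP subHD /forallP balH].
  have [//|[p0 p0H]] := set_0Vmem H.
  case: (arg_maxnP (fun p : G * G => r p.1) p0H) => -[u v] uvH u_max.
  have : 0 < outdeg H u by apply/card_gt0P; exists v; rewrite inE.
  rewrite -(eqP (balH u)) => /card_gt0P[w]; rewrite inE => wuH.
  have := u_max _ wuH; have := subHD _ wuH; rewrite !inE /= => /andP[_ ltuw].
  by rewrite leqNgt ltuw.
have D0 : set0 \in eulerian_subs D.
  rewrite inE sub0set; apply/forallP=> v; apply/eqP; rewrite /indeg /outdeg.
  by apply: eq_card => w; rewrite !inE.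
have -> : [set H in eulerian_subs D | ~~ odd #|H|] = [set set0].
  apply/setP=> H; rewrite in_set in_set1; apply/andP/eqP=> [[/eulerD//]|->].
  by rewrite D0 cards0.
have -> : [set H in eulerian_subs D | odd #|H|] = set0.
  apply/setP=> H; rewrite in_set in_set0; apply/negP=> /andP[/eulerD->].
  by rewrite cards0.
by rewrite cards1 cards0.
Qed.

End Degenerate.

(** * Cycles, decompositions and reducible configurations *)

Section Cycles.
Variables (T : finType) (e : rel T).
Hypothesis e_sym : symmetric e.

(** Longest path: its first vertex has a neighbor besides its successor, which either prolongs the
    path or lies on it and closes a cycle. The induction is on the room left for the path. *)
Lemma exists_ucycle : irreflexive e -> (exists x y, e x y) ->
  (forall x y, e x y -> exists2 z, z != x & e y z) ->
  exists2 c, 2 < size c & ucycle e c.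
Proof.
move=> e_irr [x0 [y0 xy0]] e_next.
have [n] : exists n, exists x p, [/\ path e x p, uniq (x :: p), 0 < size p
    & #|T| <= size p + n].
  exists #|T|, x0, [:: y0]; split=> //=; rewrite ?xy0 ?leq_addl // !inE andbT.
  by apply: contraTneq xy0 => ->; rewrite e_irr.
elim: n => [|n IH] [x [p [path_p uniq_p p_gt0 leTp]]].
  have : #|x :: p| <= #|T| by apply: max_card.
  rewrite (card_uniqP uniq_p) /= => lt_pT.
  by rewrite addn0 leqNgt lt_pT in leTp.
case: p p_gt0 path_p uniq_p leTp => // y p _ path_p uniq_p leTp.
have xy : e x y by case/andP: path_p.
have yx : e y x by rewrite e_sym.
have [z zy xz] := e_next _ _ yx.
have [zp|zNp] := boolP (z \in x :: y :: p); last first.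
  apply: IH; exists z, [:: x, y & p]; split=> //=; last by move: leTp => /=; lia.
  - by rewrite e_sym xz.
  - by move: uniq_p zNp => /= -> ->.
have {}zp : z \in p.
  move: zp; rewrite !inE (negPf zy) /= => /orP[/eqP eq_zx|//].
  by rewrite eq_zx e_irr in xz.
case/splitPr: p / zp path_p uniq_p {leTp IH} => p1 p2 path_p uniq_p.
exists (x :: y :: rcons p1 z); first by rewrite /= size_rcons.
move: path_p uniq_p; rewrite -cat_rcons.
rewrite -(cat_cons y) -(cat_cons x) cat_uniq cat_path.
rewrite /ucycle => /andP[path_p _] /and3P[-> _ _]; rewrite andbT.
by rewrite (_ : cycle e _ = path e x (rcons (y :: rcons p1 z) x)) // rcons_path
  path_p /= last_rcons e_sym xz.
Qed.

(** Removing a vertex of degree at most 1 lowers the degree sum by at most 2, so average degree at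
    least 2 is preserved until minimum degree 2 is reached. *)
Lemma exists_core (A : {set T}) : A != set0 ->
  2 * #|A| <= \sum_(x in A) #|[set y in A | e x y]| ->
  exists B : {set T}, [/\ B \subset A, B != set0
    & forall x, x \in B -> 1 < #|[set y in B | e x y]|].
Proof.
have [n] := ubnP #|A|; elim: n A => // n IH A leAn A0 dense.
have [core|] := boolP [forall x in A, 1 < #|[set y in A | e x y]|].
  by exists A; split=> // x; apply/forall_inP: x.
case/forall_inPn=> v vA; rewrite -leqNgt => deg_v.
have cardA : #|A| = #|A :\ v|.+1 by rewrite (cardsD1 v) vA.
have sumA : \sum_(x in A) #|[set y in A | e x y]| <=
    2 + \sum_(x in A :\ v) #|[set y in A :\ v | e x y]|.
  rewrite (big_setD1 v) //=.
  have : \sum_(x in A :\ v) #|[set y in A | e x y]| <=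
      \sum_(x in A :\ v) (#|[set y in A :\ v | e x y]| + e x v).
    apply: leq_sum => x _; rewrite (cardsD1 v) inE vA /= addnC leq_add2r.
    apply/subset_leq_card/subsetP=> y; rewrite !inE => /and3P[-> -> ->] //.
  rewrite big_split /=.
  have : \sum_(x in A :\ v) e x v <= #|[set y in A | e v y]|.
    rewrite (eq_bigr (fun x => if e x v then 1 else 0)) -?big_mkcondr; last first.
      by move=> x _; case: (e x v).
    rewrite sum1dep_card.
    apply/subset_leq_card/subsetP=> y; rewrite !inE => /andP[/andP[_ ->]].
    by rewrite e_sym.
  lia.
have A'0 : A :\ v != set0.
  apply: contraTneq dense => A'0; rewrite -ltnNge -(setD1K vA) A'0 setU0.
  rewrite big_set1 cards1; apply: leq_ltn_trans (_ : #|[set v]| < _).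
    by apply/subset_leq_card/subsetP=> y; rewrite inE => /andP[].
  by rewrite cards1.
have [||B [BA B0 coreB]] := IH _ _ A'0; try lia.
by exists B; split=> //; apply: subset_trans BA (subsetDl _ _).
Qed.
End Cycles.

Section Decomposition.
Variable G : sgraph.
Implicit Types (A B X : {set G}) (m : G -> G) (r : G -> nat).

(* A matching is given as the involution [m] exchanging its edges' ends. Ties
   in [r] are counted, so any linear order refining [r] is 2-degenerate. *)
Definition decomposable A : Prop := exists m r,
  [/\ involutive m, forall v, m v != v -> adj v (m v),
      forall v, v \in A -> m v \in A
    & forall v, v \in A ->
        #|[set w in nbrs A v | (m v != w) && (r w <= r v)]| <= 2].

Lemma decomposable0 : decomposable set0.
Proof.
by exists id, (fun=> 0); split=> // v; rewrite ?eqxx // inE.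
Qed.

(** The vertices of [X] are put after all others. So a neighbor outside [X] always counts for them,
    a neighbor in [X] only if it is not later, and the vertices outside [X] gain nothing to
    count. *)
Lemma decomposable_extend A X m r : X \subset A -> decomposable (A :\: X) ->
  involutive m -> (forall v, m v != v -> adj v (m v)) ->
  (forall v, v \in X -> m v \in X) ->
  (forall v, v \in X ->
     #|[set w in nbrs A v | (m v != w) && ((w \in X) ==> (r w <= r v))]| <= 2) ->
  decomposable A.
Proof.
move=> XA [m' [r' [m'K m'adj m'A leA]]] mK madj mX leX.
pose N := (\max_v r' v).+1.
have ltN v : r' v < N by rewrite ltnS; apply: leq_bigmax.
have mXE v : (m v \in X) = (v \in X).
  by apply/idP/idP=> [/mX|/mX //]; rewrite mK.
have m'AE v : (m' v \in A :\: X) = (v \in A :\: X).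
  by apply/idP/idP=> [/m'A|/m'A //]; rewrite m'K.
exists (fun v => if v \in X then m v else if v \in A then m' v else v).
exists (fun v => if v \in X then r v + N else r' v); split.
- move=> v /=; have [vX|vX] := boolP (v \in X); first by rewrite mXE vX mK.
  have [vA|vA] := boolP (v \in A); last by rewrite (negPf vX) (negPf vA).
  have : m' v \in A :\: X by rewrite m'AE inE vX.
  by rewrite inE => /andP[/negPf-> ->]; rewrite m'K.
- move=> v; have [vX|vX] := ifP; first exact: madj.
  by have [vA|vA] := ifP; [apply: m'adj | rewrite eqxx].
- move=> v vA; have [vX|vX] := ifPn; first by apply: (subsetP XA); apply: mX.
  have : m' v \in A :\: X by rewrite m'AE inE vX.
  by rewrite vA inE => /andP[].
- move=> v vA; have [vX|vX] := ifPn.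
    apply: leq_trans (leX v vX); apply/subset_leq_card/subsetP=> w.
    rewrite !inE => /and3P[-> -> le_r]; apply/implyP=> wX.
    by move: le_r; rewrite wX leq_add2r.
  have vAX : v \in A :\: X by rewrite inE vX.
  apply: leq_trans (leA v vAX); apply/subset_leq_card/subsetP=> w.
  rewrite vA !inE => /and3P[/andP[-> ->] ->].
  by case: ifP => [_ |_ ->//]; rewrite leqNgt (leq_trans (ltN v)) ?leq_addl.
Qed.

Lemma decomposable_degenerate : decomposable [set: G] ->
  exists M : {set {set G}}, matching M /\
  exists2 r : delete_edges M -> nat, injective r & forall v, #|back r v| <= 2.
Proof.
move=> [m [r [mK madj _ ler]]].
pose M := [set [set v; m v] | v in [set v | m v != v]].
have edgeM E x : E \in M -> x \in E -> E = [set x; m x].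
  move=> /imsetP[v _ ->]; rewrite !inE => /orP[]/eqP-> //.
  by rewrite mK setUC.
exists M; split.
  split.
    apply/subsetP=> _ /imsetP[v + ->]; rewrite inE => /madj vm.
    by apply/imsetP; exists (v, m v); rewrite ?inE.
  apply/trivIsetP=> E F EM FM; apply: contraR => /pred0Pn[x /= /andP[xE xF]].
  by rewrite (edgeM _ _ EM xE) (edgeM _ _ FM xF).
pose n := #|G|; pose r' (v : delete_edges M) := r v * n + enum_rank (v : G).
have r'_div v : r' v %/ n = r v.
  have n_gt0 : 0 < n by apply/card_gt0P; exists v.
  by rewrite divnMDl // divn_small ?addn0 // ltn_ord.
exists r' => [u v eq_r'|v].
  have := r'_div u; rewrite eq_r' r'_div => eq_r; move: eq_r'; rewrite /r' eq_r.
  by move/addnI/ord_inj/enum_rank_inj.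
apply: leq_trans (ler v _); last by rewrite inE.
apply/subset_leq_card/subsetP=> w; rewrite !inE /= => /andP[/andP[wv wvM] ltr].
rewrite adj_sym wv /= -{1}r'_div -(r'_div v) leq_div2r ?(ltnW ltr) // andbT.
apply: contra wvM => /eqP mv; apply/imsetP; exists v; last by rewrite mv setUC.
by rewrite inE mv; apply: contraTneq wv => ->; rewrite adj_irr.
Qed.

End Decomposition.

Lemma nbrs_sym (G : sgraph) (A : {set G}) u v :
  u \in A -> v \in nbrs A u -> u \in nbrs A v.
Proof. by move=> uA; rewrite !inE uA adj_sym => /andP[]. Qed.

Lemma nbrs_sub (G : sgraph) (A : {set G}) u v : v \in nbrs A u -> v \in A.
Proof. by rewrite inE => /andP[]. Qed.

Lemma nbrs_adj (G : sgraph) (A : {set G}) u v : v \in nbrs A u -> adj u v.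
Proof. by rewrite inE => /andP[]. Qed.

Lemma nbrs_neq (G : sgraph) (A : {set G}) u v : v \in nbrs A u -> v != u.
Proof. by rewrite inE => /andP[_]; apply: contraTneq => ->; rewrite adj_irr. Qed.

Lemma next_neq_prev (T : eqType) (c : seq T) x : uniq c -> 2 < size c -> x \in c ->
  next c x != prev c x.
Proof.
move=> uniq_c size_c xc; case: (rot_to xc) => i c' rot_c.
rewrite -(next_rot i) // -(prev_rot i) // rot_c.
have : uniq (x :: c') by rewrite -rot_c rot_uniq.
have : 2 < size (x :: c') by rewrite -rot_c size_rot.
case: c' {rot_c} => [|y [|z c']] // _ uniq_x.
have -> : next [:: x, y, z & c'] x = y by rewrite /= eqxx.
rewrite prev_nth inE eqxx memNindex; last by case/andP: uniq_x.
rewrite (_ : nth x _ _ = last z c'); last exact: (nth_last x [:: x, y, z & c']).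
by case/and3P: uniq_x => _ + _; apply: contra => /eqP->; apply: mem_last.
Qed.

(** * Reducible configurations in a minimal indecomposable set *)

Section MinimalCounterexample.
Variables (G : sgraph) (A : {set G}).
Hypothesis A_indec : ~ decomposable A.
Hypothesis A_min : forall B : {set G}, B \proper A -> decomposable B.

Notation deg v := #|nbrs A v|.

Lemma irreducible (X : {set G}) (m : G -> G) (r : G -> nat) x :
  x \in X -> X \subset A -> involutive m -> (forall v, m v != v -> adj v (m v)) ->
  (forall v, v \in X -> m v \in X) ->
  ~ forall v, v \in X ->
     #|[set w in nbrs A v | (m v != w) && ((w \in X) ==> (r w <= r v))]| <= 2.
Proof.
move=> xX XA mK madj mX leX; apply: A_indec.
apply: (decomposable_extend XA _ mK madj mX leX); apply: A_min.
rewrite properE subsetDl; apply/subsetPn; exists x; first exact: (subsetP XA).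
by rewrite inE xX.
Qed.

Lemma deg_ge3 v : v \in A -> 2 < deg v.
Proof.
move=> vA; rewrite ltnNge; apply/negP=> deg_v.
apply: (@irreducible [set v] id (fun=> 0) v); rewrite ?set11 ?sub1set // => u.
  by rewrite eqxx.
rewrite inE => /eqP->; apply: leq_trans deg_v.
by apply/subset_leq_card/subsetP=> w; rewrite inE => /andP[].
Qed.

Lemma card_drop1 (N : {set G}) (P : pred G) a k :
  a \in N -> ~~ P a -> #|N| <= k.+1 -> #|[set w in N | P w]| <= k.
Proof.
move=> aN Pa leN; rewrite -ltnS; apply: leq_trans leN; apply: proper_card.
rewrite properE; apply/andP; split.
  by apply/subsetP=> w; rewrite inE => /andP[].
by apply/subsetPn; exists a; rewrite // inE aN.
Qed.

Lemma card_drop2 (N : {set G}) (P : pred G) a b k : a != b ->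
  a \in N -> b \in N -> ~~ P a -> ~~ P b -> #|N| <= k.+2 ->
  #|[set w in N | P w]| <= k.
Proof.
move=> ab aN bN Pa Pb leN.
have -> : [set w in N | P w] = [set w in N :\ a | P w].
  apply/setP=> w; rewrite !inE; case: eqP => //= ->.
  by rewrite (negPf Pa) andbF.
apply: (card_drop1 (a := b)) => //; first by rewrite !inE eq_sym ab.
by move: leN; rewrite (cardsD1 a) aN.
Qed.

(** Put last and matched with each other, [u] and [v] keep two counted neighbors each. *)
Lemma no_adjacent_3 u v : u \in A -> v \in nbrs A u -> deg u = 3 -> deg v <> 3.
Proof.
move=> uA vu deg_u deg_v; have uv := nbrs_sym uA vu.
have uNv := nbrs_neq vu.
pose m x := if x == u then v else if x == v then u else x.
apply: (@irreducible [set u; v] m (fun=> 0) u); rewrite ?inE ?eqxx //.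
- by apply/subsetP=> w; rewrite !inE => /orP[]/eqP-> //; apply: nbrs_sub vu.
- move=> x; rewrite /m; have [->|xu] := eqVneq x u.
    by rewrite (negPf uNv) eqxx.
  by have [->|xv] := eqVneq x v; rewrite ?eqxx // (negPf xu) (negPf xv).
- move=> x; rewrite /m; have [->|xu] := eqVneq x u; first by rewrite (nbrs_adj vu).
  by have [->|xv] := eqVneq x v; rewrite ?eqxx // (nbrs_adj uv).
- by move=> x; rewrite !inE /m => /orP[]/eqP->;
    rewrite ?eqxx ?(negPf uNv) ?eqxx ?orbT.
- move=> x; rewrite !inE => /orP[]/eqP->.
    by apply: (card_drop1 vu); rewrite ?deg_u // /m eqxx eqxx.
  by apply: (card_drop1 uv); rewrite ?deg_v // /m (negPf uNv) !eqxx.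
Qed.

Lemma no_344_with_3 v u b v' : v \in A -> u \in nbrs A v -> b \in nbrs A v ->
  b \in nbrs A u -> v' \in nbrs A u -> v' != v ->
  deg v = 3 -> deg u = 4 -> deg b = 4 -> deg v' = 3 -> False.
Proof.
move=> vA uv bv bu v'u v'v dv du db dv'.
have uA := nbrs_sub uv; have bA := nbrs_sub bv; have v'A := nbrs_sub v'u.
have vb := nbrs_sym vA bv; have vu := nbrs_sym vA uv.
have ub := nbrs_sym uA bu; have uv' := nbrs_sym uA v'u.
have n1 := nbrs_neq bv; have n2 := nbrs_neq uv; have n3 := nbrs_neq bu.
have n4 := nbrs_neq v'u.
have n5 : v' != b by apply/eqP=> eq_b; rewrite eq_b db in dv'.
pose m x := if x == v then b else if x == b then v else
            if x == u then v' else if x == v' then u else x.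
have mv : m v = b by rewrite /m eqxx.
have mb : m b = v by rewrite /m (negPf n1) eqxx.
have mu : m u = v' by rewrite /m (negPf n2) eq_sym (negPf n3) eqxx.
have mv' : m v' = u by rewrite /m (negPf v'v) (negPf n5) (negPf n4) eqxx.
have mx x : x != v -> x != b -> x != u -> x != v' -> m x = x.
  by rewrite /m => /negPf-> /negPf-> /negPf-> /negPf->.
pose r x := if x == b then 0 else if x == u then 1 else 2.
have rv : r v = 2 by rewrite /r eq_sym (negPf n1) eq_sym (negPf n2).
have rb : r b = 0 by rewrite /r eqxx.
have ru : r u = 1 by rewrite /r eq_sym (negPf n3) eqxx.
apply: (@irreducible [set v; b; u; v'] m r v).
- by rewrite !inE eqxx.
- by apply/subsetP=> w; rewrite !inE -!orbA => /or4P[]/eqP->.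
- move=> x; have [->|xv] := eqVneq x v; first by rewrite mv.
  have [->|xb] := eqVneq x b; first by rewrite mb.
  have [->|xu] := eqVneq x u; first by rewrite mu.
  have [->|xv'] := eqVneq x v'; first by rewrite mv'.
  by rewrite !mx.
- move=> x; have [->|xv] := eqVneq x v; first by rewrite mv (nbrs_adj bv).
  have [->|xb] := eqVneq x b; first by rewrite mb (nbrs_adj vb).
  have [->|xu] := eqVneq x u; first by rewrite mu (nbrs_adj v'u).
  have [->|xv'] := eqVneq x v'; first by rewrite mv' (nbrs_adj uv').
  by rewrite mx ?eqxx.
- by move=> x; rewrite !inE -!orbA => /or4P[]/eqP->;
    rewrite ?mv ?mb ?mu ?mv' eqxx ?orbT.
move=> x; rewrite !inE -!orbA => /or4P[]/eqP->.
- by apply: (card_drop1 bv); rewrite ?dv // mv eqxx.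
- apply: (card_drop2 _ vb ub); rewrite ?db ?mb ?eqxx //; first by rewrite eq_sym.
  by rewrite !inE eqxx rb ru !orbT andbF.
- apply: (card_drop2 _ v'u vu); rewrite ?du ?mu ?eqxx //.
  by rewrite !inE eqxx rv ru andbF.
- by apply: (card_drop1 uv'); rewrite ?dv' // mv' eqxx.
Qed.

Definition edge34 : rel G := [rel x y | [&& x \in A, y \in nbrs A x
  & (deg x == 3) && (deg y == 4) || (deg x == 4) && (deg y == 3)]].

Lemma edge34_sym : symmetric edge34.
Proof.
have H x y : edge34 x y -> edge34 y x.
  move=> /and3P[xA yx dxy]; apply/and3P; split.
  - exact: nbrs_sub yx.
  - exact: nbrs_sym yx.
  - by rewrite orbC ![(deg y == _) && _]andbC.
by move=> x y; apply/idP/idP; apply: H.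
Qed.

(** Each 3-vertex is matched with its successor on the cycle, and the 3-vertices are ordered after
    the 4-vertices. A 3-vertex drops its partner; a 4-vertex drops both neighbors on the cycle, the
    previous one being its partner and the next one later in the order. *)
Lemma no_cycle34 c : 2 < size c -> ~ ucycle edge34 c.
Proof.
move=> size_c /andP[cyc uniq_c].
have nextP x : x \in c -> edge34 x (next c x) by apply: next_cycle.
have prevP x : x \in c -> edge34 x (prev c x).
  by move=> xc; rewrite edge34_sym; apply: prev_cycle.
have alt x y : edge34 x y -> (deg y == 3) = (deg x != 3).
  by move=> /and3P[_ _ /orP[]/andP[/eqP-> /eqP->]].
pose m x := if x \in c then if deg x == 3 then next c x else prev c x else x.
have mE x : x \in c -> m x = if deg x == 3 then next c x else prev c x.
  by rewrite /m => ->.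
have mc x : (m x \in c) = (x \in c).
  by rewrite /m; case: (boolP (x \in c)) => xc; rewrite ?(negPf xc) //;
    case: ifP => _; rewrite ?mem_next ?mem_prev.
have m34 x : x \in c -> edge34 x (m x).
  by move=> xc; rewrite /m xc; case: ifP => _; [apply: nextP | apply: prevP].
have [x xc] : exists x, x \in c.
  by case: (c) size_c => // x s _; exists x; rewrite inE eqxx.
apply: (@irreducible [set x in c] m (fun x => deg x == 3) x).
- by rewrite inE.
- by apply/subsetP=> y; rewrite inE => /nextP/and3P[].
- move=> y; case: (boolP (y \in c)) => yc; last by rewrite /m !(negPf yc).
  rewrite (mE (m y)) ?mc // (alt _ _ (m34 y yc)) (mE y yc).
  by case: (deg y == 3); rewrite /= ?prev_next ?next_prev.
- move=> y; case: (boolP (y \in c)) => yc; last by rewrite /m (negPf yc) eqxx.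
  by have /and3P[_ /nbrs_adj -> _] := m34 y yc.
- by move=> y; rewrite !inE mc.
move=> y; rewrite inE => yc; have := m34 y yc => /and3P[yA my].
case/orP=> /andP[/eqP dy /eqP dmy].
  by apply: (card_drop1 my); rewrite ?dy // eqxx.
have /and3P[_ ny] := nextP y yc; rewrite dy /= => /eqP dny.
apply: (card_drop2 _ my ny); rewrite ?dy ?eqxx //.
  by rewrite mE // dy eq_sym next_neq_prev.
by rewrite inE mem_next yc dny eqxx andbF.
Qed.

End MinimalCounterexample.

(** * Discharging *)

Lemma leq_sum_seq_set (T : finType) (S : {set T}) (s : seq T) (F : T -> nat) :
  uniq s -> {subset s <= S} -> \sum_(x <- s) F x <= \sum_(x in S) F x.
Proof.
move=> uniq_s sS; rewrite big_uniq //= (bigID (mem s) (mem S)) /=.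
apply: leq_trans (leq_addr _ _); apply/eq_leq/eq_bigl => x.
by apply/idP/andP=> [xs|[]//]; split=> //; apply: sS.
Qed.

Section ShortCycles.
Variable G : sgraph.
Implicit Types a b c d : G.

Lemma adj_neq a b : adj a b -> a != b.
Proof. by apply: contraTneq => ->; rewrite adj_irr. Qed.

Lemma has_cycle3 a b c : adj a b -> adj b c -> adj c a -> has_cycle G 3.
Proof.
move=> ab bc ca; split=> //; exists [:: a; b; c]; split=> //.
rewrite /ucycle /= ab bc ca !inE negb_or (adj_neq ab) (adj_neq bc).
by rewrite eq_sym (adj_neq ca).
Qed.

Lemma has_cycle4 a b c d : adj a b -> adj b c -> adj c d -> adj d a ->
  a != c -> b != d -> has_cycle G 4.
Proof.
move=> ab bc cd da ac bd; split=> //; exists [:: a; b; c; d]; split=> //.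
rewrite /ucycle /= ab bc cd da !inE !negb_or (adj_neq ab) (adj_neq bc).
by rewrite (adj_neq cd) ac bd eq_sym (adj_neq da).
Qed.

Lemma has_cycle6 (s : seq G) : cycle (@adj G) s -> uniq s -> size s = 6 ->
  has_cycle G 6.
Proof. by move=> cyc uniq_s size_s; split=> //; exists s; rewrite /ucycle cyc. Qed.

End ShortCycles.

Ltac distinct :=
  rewrite /= ?inE ?negb_or ?andbT; repeat (apply/andP; split);
  solve [ by [] | assumption | rewrite eq_sym; assumption
        | apply: adj_neq; assumption | rewrite eq_sym; apply: adj_neq; assumption ].

(** * Boundaries and sizes of regions *)

Section Regions.
Variables (G : sgraph) (A : {set G}) (D : drawing A).
Hypothesis deg_gt2 : forall v, v \in A -> 2 < #|nbrs A v|.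

Notation deg v := #|nbrs A v|.
Notation reg := (@region G A D).
Implicit Types (u v w x y z : G) (rho sigma : regions D) (S : {set regions D}).

Definition side_mult rho u v : nat :=
  (reg u v true == rho) + (reg u v false == rho).

Definition touch rho : rel G :=
  [rel u v | [&& u \in A, v \in nbrs A u & 0 < side_mult rho u v]].

Definition sides_at rho v := \sum_(w in nbrs A v) side_mult rho v w.

(* Twice the length of the boundary of [rho]: a side is counted from both of
   its ends, and an edge with [rho] on both sides has two sides. *)
Definition region_size rho := \sum_(v in A) sides_at rho v.

Lemma touchP rho u v : reflect (exists b, [/\ u \in A, v \in nbrs A u & reg u v b = rho])
  (touch rho u v).
Proof.
apply: (iffP and3P) => [[uA vu]|[b [uA vu <-]]]; last first.
  by split=> //; rewrite /side_mult; case: b; rewrite eqxx ?addn1.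
rewrite addn_gt0 !lt0b => /orP[]/eqP.
  by exists true.
by exists false.
Qed.

Lemma touch_reg u v b : u \in A -> v \in nbrs A u -> touch (reg u v b) u v.
Proof. by move=> uA vu; apply/touchP; exists b. Qed.

Lemma touch_sym rho : symmetric (touch rho).
Proof.
have H u v : touch rho u v -> touch rho v u.
  move=> /touchP[b [uA vu <-]]; apply/touchP; exists b; split.
  - exact: nbrs_sub vu.
  - exact: nbrs_sym.
  - exact: region_sym.
by move=> u v; apply/idP/idP; apply: H.
Qed.

Lemma touchA rho u v : touch rho u v -> u \in A.
Proof. by case/and3P. Qed.

Lemma touch_nbrs rho u v : touch rho u v -> v \in nbrs A u.
Proof. by case/and3P. Qed.

Lemma touch_adj rho u v : touch rho u v -> adj u v.
Proof. by case/and3P=> _ /nbrs_adj. Qed.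

Lemma touch_irr rho : irreflexive (touch rho).
Proof. by move=> u; apply/negP=> /touch_adj; rewrite adj_irr. Qed.

Lemma touch_neq rho u v : touch rho u v -> u != v.
Proof. by move/touch_adj/adj_neq. Qed.

Lemma touchE rho u v : u \in A -> v \in nbrs A u ->
  touch rho u v = (reg u v true == rho) || (reg u v false == rho).
Proof. by move=> uA vu; rewrite /touch /= uA vu addn_gt0 !lt0b. Qed.

Lemma region_even1 rho v : v \in A ->
  ~~ odd #|[set w in nbrs A v | (reg v w true == rho) (+) (reg v w false == rho)]|.
Proof.
move=> vA; have := region_even [set rho] vA.
by congr (~~ odd #|pred_of_set _|); apply/setP=> w; rewrite !inE.
Qed.

(** If [rho] lay on both sides of [v y], only [v z] could have it on exactly one side, which parity
    forbids. So [rho] has no boundary at [v] and contains all sides there, and [v] has degree at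
    most 2. *)
Lemma side_mult1 rho v y z : touch rho v y ->
  (forall w, touch rho v w -> w \in [:: y; z]) -> side_mult rho v y = 1.
Proof.
move=> vy only_yz; have vA := touchA vy; have yv := touch_nbrs vy.
have : 0 < side_mult rho v y <= 2.
  by case/and3P: vy => _ _ ->; rewrite /side_mult; do 2![case: eqP => _].
case m_eq: (side_mult rho v y) => [|[|[|//]]] //= _.
have [t_y f_y] : reg v y true = rho /\ reg v y false = rho.
  by move: m_eq; rewrite /side_mult; do 2![case: eqP => //].
have bothE w : w \in nbrs A v -> (reg v w true == rho) = (reg v w false == rho).
  move=> wv; set X := [set w in nbrs A v | (reg v w true == rho) (+) (reg v w false == rho)].
  have Xz x : x \in X -> x = z.
    rewrite inE => /andP[xv x_xor]; have : touch rho v x.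
      by rewrite touchE //; move: x_xor; do 2![case: (_ == rho)].
    move/only_yz; rewrite !inE => /orP[/eqP eq_xy|/eqP//].
    by rewrite eq_xy t_y f_y eqxx in x_xor.
  have [wX|] := boolP (w \in X); last by rewrite inE wv; do 2![case: (_ == rho)].
  have := region_even1 rho vA; rewrite -/X.
  have -> : X = [set w].
    apply/setP=> x; rewrite in_set1; apply/idP/eqP=> [xX|->//].
    by rewrite (Xz _ xX) (Xz _ wX).
  by rewrite cards1.
have all_rho w : w \in nbrs A v -> touch rho v w.
  move=> wv; have := @region_closed _ _ D [set rho] v vA _ y w true true yv wv.
  rewrite !inE t_y eqxx touchE // => -> // x xv.
  by rewrite !inE bothE.
have : nbrs A v \subset [set y; z].
  apply/subsetP=> w /all_rho/only_yz; by rewrite !inE.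
move/subset_leq_card; have := deg_gt2 vA; rewrite cards2; case: (_ != _); lia.
Qed.

(** If [rho] touched no other edge at [v], then by [side_mult1] the edge [v u] would be the only one
    there with [rho] on exactly one side, against parity. *)
Lemma touch_next rho u v : touch rho u v -> exists2 w, w != u & touch rho v w.
Proof.
rewrite touch_sym => vu; have vA := touchA vu; have uv := touch_nbrs vu.
have [/existsP[w /andP[wu vw]]|no_w] := boolP [exists w, (w != u) && touch rho v w].
  by exists w.
have only_u w : touch rho v w -> w = u.
  move=> vw; apply/eqP; apply: contraNT no_w => wu; apply/existsP; exists w.
  by rewrite wu.
have m1 : side_mult rho v u = 1.
  by apply: (side_mult1 (z := u) vu) => w /only_u ->; rewrite inE eqxx.
have := region_even1 rho vA.
rewrite (_ : [set w in _ | _] = [set u]) ?cards1 //.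
apply/setP=> w; rewrite in_set1 inE; apply/andP/eqP=> [[wv w_xor]|->].
  by apply: only_u; rewrite touchE //; move: w_xor; do 2![case: (_ == rho)].
by split=> //; move: m1; rewrite /side_mult; do 2![case: (_ == rho)].
Qed.

(* If all edges of two regions at [a] go to [b] and [c], both regions lie on
   both edges, so they surround [a], which then has degree 2. *)
Lemma two_regions_degree rho sigma a b c : rho != sigma ->
  touch rho a b -> touch sigma a b -> touch rho a c -> touch sigma a c ->
  (forall w, touch rho a w -> w \in [:: b; c]) ->
  ~ forall w, touch sigma a w -> w \in [:: b; c].
Proof.
move=> neq_rs rab sab rac sac only_r only_s; have aA := touchA rab.
pose S := [set rho; sigma].
have inS w d : touch rho a w -> touch sigma a w -> reg a w d \in S.
  move=> raw saw; move: (raw) (saw); have wa := touch_nbrs raw.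
  rewrite !touchE // !inE.
  move=> /orP[]/eqP eq_r /orP[]/eqP eq_s; case: d; rewrite ?eq_r ?eq_s ?eqxx ?orbT //;
   by move: neq_rs; rewrite -eq_r -eq_s eqxx.
have touchS w d : w \in nbrs A a -> reg a w d \in S -> w \in [:: b; c].
  move=> wa; rewrite !inE => /orP[]/eqP eq_reg.
    by have := only_r w; rewrite !inE; apply; rewrite -eq_reg touch_reg.
  by have := only_s w; rewrite !inE; apply; rewrite -eq_reg touch_reg.
have bcS w d : w \in [:: b; c] -> reg a w d \in S.
  by move=> w_bc; apply: inS; move: w_bc; rewrite !inE => /orP[]/eqP->.
have sub_bc : nbrs A a \subset [set b; c].
  apply/subsetP=> w wa; have: reg a w true \in S.
    apply: (@region_closed _ _ D S a aA _ b w true true _ wa).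
    - move=> x xa; apply/idP/idP=> /(touchS _ _ xa)/bcS; exact.
    - exact: touch_nbrs rab.
    - by apply: bcS; rewrite inE eqxx.
  by move/(touchS _ _ wa); rewrite !inE.
move/subset_leq_card: sub_bc; have := deg_gt2 aA; rewrite cards2; case: (_ != _); lia.
Qed.

Lemma sides_at_geq rho v (s : seq G) : uniq s -> all (touch rho v) s ->
  size s <= sides_at rho v.
Proof.
move=> uniq_s /allP tou; apply: leq_trans (leq_sum_seq_set _ uniq_s _).
  rewrite -sum1_size big_seq [leqRHS]big_seq; apply: leq_sum => w /tou.
  by case/and3P.
by move=> w /tou/touch_nbrs.
Qed.

Lemma sides_at_ge2 rho u v : touch rho u v -> 1 < sides_at rho u.
Proof.
move=> uv; have vu : touch rho v u by rewrite touch_sym.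
have [w wv uw] := touch_next vu.
by apply: (@sides_at_geq rho u [:: v; w]); rewrite /= ?inE ?uv ?uw // eq_sym wv.
Qed.

Lemma region_size_geq rho (s : seq G) : uniq s -> {subset s <= A} ->
  sumn [seq sides_at rho v | v <- s] <= region_size rho.
Proof. by rewrite sumnE big_map; apply: leq_sum_seq_set. Qed.

Definition touched rho v := [exists w, touch rho v w].

Lemma touchedl rho u v : touch rho u v -> touched rho u.
Proof. by move=> uv; apply/existsP; exists v. Qed.

Lemma touchedr rho u v : touch rho u v -> touched rho v.
Proof. by rewrite touch_sym; apply: touchedl. Qed.

Lemma region_size_touched rho (s : seq G) : uniq s -> all (touched rho) s ->
  2 * size s <= region_size rho.
Proof.
move=> uniq_s /allP tou; apply: leq_trans (region_size_geq _ uniq_s _).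
  rewrite sumnE big_map.
  have -> : 2 * size s = \sum_(v <- s) 2.
    by rewrite big_const_seq count_predT iter_addn_0.
  rewrite big_seq [leqRHS]big_seq.
  by apply: leq_sum => v /tou/existsP[w]; apply: sides_at_ge2.
by move=> v /tou/existsP[w /touchA].
Qed.

(** As there are no dead ends, the edges touching [rho] contain a cycle; each of its vertices
    accounts for at least two sides. *)
Lemma region_cycle rho u v : touch rho u v ->
  exists c, [/\ 2 < size c, ucycle (@adj G) c, ucycle (touch rho) c
    & 2 * size c <= region_size rho].
Proof.
move=> uv.
have [|c size_c /andP[cyc_c uniq_c]] :=
  exists_ucycle (@touch_sym rho) (@touch_irr rho) _ (@touch_next rho).
  by exists u, v.
exists c; split=> //; rewrite /ucycle ?cyc_c ?uniq_c ?andbT //.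
  by apply: sub_cycle cyc_c => x y; apply: touch_adj.
apply: region_size_touched => //; apply/allP=> x xc; apply/existsP.
by exists (next c x); apply: next_cycle.
Qed.

(* Each region passes its unit of charge to its sides; together with Euler's
   inequality this bounds the degree sum. *)
Lemma charge (f : regions D -> nat) N :
  (forall rho u v, touch rho u v -> N <= f rho * region_size rho) ->
  N * \sum_(v in A) deg v <= 2 * N * #|A| +
    2 * \sum_(v in A) \sum_(w in nbrs A v) (f (reg v w true) + f (reg v w false)).
Proof.
move=> leN; set I := [set reg p.1.1 p.1.2 p.2 | p in sides A].
have euler : 2 * \sum_(v in A) deg v <= 4 * #|A| + 4 * #|I|.
  apply: leq_trans (region_euler D); apply: eq_leq.
  transitivity (\sum_(v in A) \sum_(w in nbrs A v) \sum_(b : bool) 1).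
    rewrite big_distrr; apply: eq_bigr => v _ /=.
    under eq_bigr => w _ do rewrite big_bool.
    by rewrite sum_nat_const mulnC.
  rewrite pair_big_dep pair_big_dep /= sum1dep_card.
  by apply: eq_card => p; rewrite !inE andbT.
suff : N * #|I| <=
    \sum_(v in A) \sum_(w in nbrs A v) (f (reg v w true) + f (reg v w false)).
  by move: euler; move: (\sum_(v in A) deg v) (\sum_(v in A) _); nia.
rewrite mulnC -sum_nat_const.
apply: leq_trans (_ : \sum_(rho in I) f rho * region_size rho <= _).
  apply: leq_sum => rho /imsetP[[[u v] b]]; rewrite inE /= => /andP[uA vu] ->.
  by apply: leN (touch_reg b uA vu).
rewrite /region_size; under eq_bigr => rho _ do rewrite big_distrr /=.
rewrite exchange_big /=; apply: leq_sum => v vA.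
rewrite /sides_at; under eq_bigr => rho _ do rewrite big_distrr /=.
rewrite exchange_big /=; apply: leq_sum => w wv.
under eq_bigr => rho _ do rewrite /side_mult mulnDr.
have one (sigma : regions D) : \sum_(rho in I) f rho * (sigma == rho) <= f sigma.
  rewrite (bigID (pred1 sigma)) /= [X in _ + X]big1 ?addn0; last first.
    by move=> rho /andP[_ /negPf]; rewrite eq_sym => ->; rewrite muln0.
  apply: leq_trans (_ : \sum_(rho | rho == sigma) f rho <= _); last first.
    by rewrite big_pred1_eq.
  rewrite big_andbC big_mkcondr /=; apply: leq_sum => rho /eqP->.
  by rewrite eqxx muln1; case: ifP.
by rewrite big_split leq_add.
Qed.

End Regions.

(** * Degree counts, and graphs without 3-cycles *)

Section Counting.
Variables (G : sgraph) (A : {set G}).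
Hypothesis A_indec : ~ decomposable A.
Hypothesis A_min : forall B : {set G}, B \proper A -> decomposable B.
Variable D : drawing A.

Notation deg v := #|nbrs A v|.
Notation reg := (@region G A D).
Implicit Types (u v w x y z : G) (rho sigma : regions D).

Lemma A_neq0 : exists v, v \in A.
Proof.
apply/set0Pn; apply: contra_notN A_indec => /eqP->; exact: decomposable0.
Qed.

Let deg_gt2 v : v \in A -> 2 < deg v.
Proof. exact: (deg_ge3 A_indec A_min). Qed.

Lemma nbr_of_3 v w : v \in A -> w \in nbrs A v -> deg v = 3 -> 3 < deg w.
Proof.
move=> vA wv dv; have := no_adjacent_3 A_indec A_min vA wv dv.
by have := deg_gt2 (nbrs_sub wv); lia.
Qed.

Lemma sum_nbrs_exchange (P Q : pred G) (g : G -> G -> nat) :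
  \sum_(v in A | P v) \sum_(w in nbrs A v | Q w) g v w =
  \sum_(w in A | Q w) \sum_(v in nbrs A w | P v) g v w.
Proof.
rewrite (exchange_big_dep (fun w => (w \in A) && Q w)) /=; last first.
  by move=> v w _ /andP[/nbrs_sub-> ->].
apply: eq_bigr => w /andP[wA Qw]; apply: eq_bigl => v; rewrite Qw andbT.
apply/andP/andP=> [[/andP[vA Pv] wv]|[vw Pv]].
  by split=> //; apply: nbrs_sym.
by rewrite (nbrs_sub vw) Pv (nbrs_sym _ vw).
Qed.

Lemma sum_nbrs_leq (P Q : pred G) :
  \sum_(v in A | P v) \sum_(w in nbrs A v | Q w) 1 <= \sum_(w in A | Q w) deg w.
Proof.
rewrite sum_nbrs_exchange; apply: leq_sum => w _; rewrite sum1dep_card.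
by apply/subset_leq_card/subsetP=> v; rewrite !inE => /andP[].
Qed.

(** Neighbors of 3-vertices have degree at least 4; the edges to those of degree 5 or more are
    bounded by the degrees there. *)
Lemma count3 : 3 * #|[set v in A | deg v == 3]| <=
  \sum_(v in A | deg v == 3) \sum_(w in nbrs A v | deg w == 4) 1 +
  \sum_(v in A | 4 < deg v) deg v.
Proof.
apply: leq_trans (leq_add (leqnn _) (sum_nbrs_leq (fun v => deg v == 3) _)).
rewrite -big_split mulnC -sum_nat_const; apply: eq_leq => /=.
under eq_bigl => v do rewrite inE.
apply: eq_bigr => v /andP[vA /eqP dv].
rewrite -[LHS]dv -sum1_card (bigID (fun w => deg w == 4)) /=; congr addn.
apply: eq_bigl => w; case wv: (w \in nbrs A v) => //=.
by have := nbr_of_3 vA wv dv; lia.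
Qed.

(** More edges than vertices would leave a core of minimum degree 2, hence a cycle alternating
    between degrees 3 and 4. *)
Lemma forest34 :
  \sum_(v in A | deg v == 3) \sum_(w in nbrs A v | deg w == 4) 1 <=
  #|[set v in A | deg v == 3]| + #|[set v in A | deg v == 4]|.
Proof.
set E := \sum_(v in A | _) _; set n3 := #|_|; set n4 := #|_|.
pose A34 := [set v in A | (deg v == 3) || (deg v == 4)].
have cardA34 : #|A34| = n3 + n4.
  rewrite -cardsUI [X in _ = _ + X](_ : _ = 0) ?addn0.
    by apply: eq_card => v; rewrite !inE andb_orr.
  apply/eqP; rewrite cards_eq0; apply/eqP/setP=> v; rewrite !inE.
  by apply/negP=> /andP[/andP[_ /eqP->] /andP[_]].
have sumE : \sum_(v in A34) #|[set w in A34 | edge34 A v w]| = 2 * E.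
  have EE : \sum_(v in A | deg v == 4) \sum_(w in nbrs A v | deg w == 3) 1 = E.
    exact: sum_nbrs_exchange.
  rewrite mul2n -addnn -{2}EE (bigID (fun v => deg v == 3)) /=.
  congr addn; apply: eq_big => v; try by rewrite inE; lia.
    rewrite inE => /andP[/andP[vA _] /eqP dv].
    rewrite sum1dep_card; apply: eq_card => w; rewrite !inE /edge34 /= !inE vA dv /=.
    case: (w \in A) => //; case: (adj v w); rewrite ?andbF //=.
    by case: (deg w == 4); rewrite ?orbT ?orbF ?andbF.
  rewrite inE => /andP[/andP[vA d34] /negPf dv].
  rewrite sum1dep_card; apply: eq_card => w; rewrite !inE /edge34 /= !inE vA.
  move: d34; rewrite dv => /= ->.
  case: (w \in A) => //; case: (adj v w); rewrite ?andbF //=.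
  by case: (deg w == 3); rewrite ?orbT ?orbF ?andbF.
rewrite -(leq_pmul2l (isT : 0 < 2)) -sumE -cardA34 leqNgt; apply/negP=> dense.
have A34_neq0 : A34 != set0.
  by apply: contraTneq dense => ->; rewrite cards0 big_set0.
have [B [BA B0 coreB]] := exists_core (@edge34_sym G A) A34_neq0 (ltnW dense).
pose e := [rel x y | [&& x \in B, y \in B & edge34 A x y]].
have e_sym : symmetric e.
  by move=> x y; rewrite /e /= edge34_sym; case: (x \in B); case: (y \in B).
have [|||c size_c /andP[cyc_c uniq_c]] := exists_ucycle e_sym.
- by move=> x; rewrite /e /edge34 /= !inE adj_irr !andbF.
- have [x xB] := set0Pn _ B0; have /ltnW/card_gt0P[y] := coreB x xB.
  by rewrite inE => /andP[yB xy]; exists x, y; rewrite /e /= xB yB.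
- move=> x y /= /and3P[xB yB _]; have := coreB y yB.
  rewrite (cardsD1 x) => gt1; have /card_gt0P[z] :
      0 < #|[set z in B | edge34 A y z] :\ x|.
    by move: gt1; case: (_ \in _); lia.
  by rewrite !inE => /and3P[zx zB yz]; exists z; rewrite //= yB zB.
apply: (no_cycle34 A_indec A_min size_c); rewrite /ucycle uniq_c andbT.
by apply: sub_cycle cyc_c => x y /and3P[].
Qed.

Notation n3 := #|[set v in A | deg v == 3]|.
Notation n4 := #|[set v in A | deg v == 4]|.
Notation n5 := #|[set v in A | 4 < deg v]|.
Notation degsum5 := (\sum_(v in A | 4 < deg v) deg v).

Lemma sum_by_degree (g : G -> nat) : \sum_(v in A) g v =
  \sum_(v in A | deg v == 3) g v + \sum_(v in A | deg v == 4) g v +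
  \sum_(v in A | 4 < deg v) g v.
Proof.
rewrite (bigID (fun v => deg v == 3)) -addnA; congr addn.
rewrite (bigID (fun v => deg v == 4)) /=; congr addn; apply: eq_bigl => v.
  by case vA: (v \in A) => //=; lia.
by case vA: (v \in A) => //=; have := deg_gt2 vA; lia.
Qed.

Lemma sum_cond_const (P : pred G) (g : G -> nat) k :
  (forall v, v \in A -> P v -> g v = k) ->
  \sum_(v in A | P v) g v = k * #|[set v in A | P v]|.
Proof.
move=> gk; rewrite mulnC -sum_nat_const; under [RHS]eq_bigl => v do rewrite inE.
by apply: eq_bigr => v /andP[]; apply: gk.
Qed.

Lemma degree_sum : \sum_(v in A) deg v = 3 * n3 + 4 * n4 + degsum5.
Proof.
by rewrite sum_by_degree; congr (_ + _ + _); apply: sum_cond_const => v _ /eqP.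
Qed.

Lemma card_by_degree : #|A| = n3 + n4 + n5.
Proof.
by rewrite -sum1_card sum_by_degree !(@sum_cond_const _ _ 1) // !mul1n.
Qed.

Lemma n5_leq : 5 * n5 <= degsum5.
Proof.
rewrite -(@sum_cond_const (fun v => 4 < deg v) (fun=> 5)) //.
by apply: leq_sum => v /andP[].
Qed.

Lemma A_gt0 : 0 < #|A|.
Proof. by have [v vA] := A_neq0; apply/card_gt0P; exists v. Qed.

Lemma no_34 : ~ has_cycle G 3 -> ~ has_cycle G 4 -> False.
Proof.
move=> no3 no4.
have size10 rho u v : touch rho u v -> 10 <= 1 * region_size rho.
  move=> uv; have [c [size_c cyc_c _ le_c]] := region_cycle deg_gt2 uv.
  have c3 : size c <> 3 by move=> eq3; apply: no3; split=> //; exists c.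
  have c4 : size c <> 4 by move=> eq4; apply: no4; split=> //; exists c.
  lia.
have := charge size10.
have -> : \sum_(v in A) \sum_(w in nbrs A v) (1 + 1) = 2 * \sum_(v in A) deg v.
  by rewrite big_distrr; apply: eq_bigr => v _; rewrite sum_nat_const mulnC.
(* The degree sum s satisfies 3 s <= 10 n, which by 5 n5 <= [degsum5] yields 2 n4 + [degsum5] <= n3.
   But 3 n3 <= 4 n4 + [degsum5], so [A] would be empty. *)
have := count3; have := sum_nbrs_leq (fun v => deg v == 3) (fun v => deg v == 4).
rewrite (@sum_cond_const (fun v => deg v == 4) _ 4); last by move=> v _ /eqP.
have := A_gt0; rewrite degree_sum card_by_degree; have := n5_leq.
by move: (n5) (n4) (n3) degsum5 => a b c d; lia.
Qed.

Section TriangleAndHexagonFree.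
Hypotheses (no3 : ~ has_cycle G 3) (no6 : ~ has_cycle G 6).

Lemma no_triangle (a b c : G) : adj a b -> adj b c -> adj c a -> False.
Proof. by move=> ab bc /(has_cycle3 ab bc). Qed.

(** Five touched vertices would make the size at least 10; as triangles are excluded, [rho] is
    bounded by a 4-cycle [u v x y]. *)
Lemma quad_region rho u v : touch rho u v -> region_size rho < 10 ->
  exists x y, [/\ touch rho v x, touch rho x y, touch rho y u,
    (u != x) && (v != y)
    & (forall w, touch rho v w -> w \in [:: u; x]) /\
      (forall w, touch rho u w -> w \in [:: v; y])].
Proof.
move=> uv small; have vu : touch rho v u by rewrite touch_sym.
have [x xu vx] := touch_next deg_gt2 uv.
have [y yv uy] := touch_next deg_gt2 vu.
have auv := touch_adj uv; have avx := touch_adj vx; have auy := touch_adj uy.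
have xy : x != y.
  apply/eqP=> eq_xy; apply: (no_triangle auv avx); rewrite eq_xy adj_sym.
  exact: auy.
have uniq4 : uniq [:: u; v; x; y].
  rewrite /= !inE !negb_or (adj_neq auv) (adj_neq avx) (adj_neq auy) xy.
  by rewrite ![_ == x]eq_sym ![v == _]eq_sym xu yv.
have fifth w z : touch rho z w -> w \in [:: u; v; x; y].
  move=> zw; apply: contraTT small => w_out; rewrite -leqNgt.
  apply: (@region_size_touched _ _ _ deg_gt2 rho [:: w; u; v; x; y]).
    by rewrite cons_uniq w_out.
  by rewrite /= (touchedr zw) (touchedl uv) (touchedl vu) (touchedr vx) (touchedr uy).
have only_v w : touch rho v w -> w \in [:: u; x].
  move=> vw; have := fifth w v vw; rewrite !inE => /or4P[->//|/eqP eq_w|->|/eqP eq_w].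
  - by rewrite eq_w touch_irr in vw.
  - by rewrite orbT.
  - by case: (no_triangle auy _ (_ : adj v u)); rewrite 1?adj_sym // -eq_w (touch_adj vw).
have only_u w : touch rho u w -> w \in [:: v; y].
  move=> uw; have := fifth w u uw; rewrite !inE => /or4P[/eqP eq_w|->//|/eqP eq_w|->].
  - by rewrite eq_w touch_irr in uw.
  - by case: (no_triangle auv avx); rewrite adj_sym -eq_w (touch_adj uw).
  - by rewrite orbT.
exists x, y; split=> //.
- have xv : touch rho x v by rewrite touch_sym.
  have [z zv xz] := touch_next deg_gt2 vx.
  have := fifth z x xz; rewrite !inE => /or4P[/eqP eq_z|/eqP eq_z|/eqP eq_z|/eqP<-//].
  + by case: (no_triangle auv avx); rewrite -eq_z (touch_adj xz).
  + by rewrite eq_z eqxx in zv.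
  + by rewrite eq_z touch_irr in xz.
- by rewrite touch_sym.
- by rewrite eq_sym xu eq_sym yv.
Qed.

(** Two quadrilaterals on [u v] form a 6-cycle unless they share a further vertex. If they agree
    next to [v] or next to [u], both regions surround that vertex, against [two_regions_degree]; any
    other coincidence yields a triangle. *)
Lemma quad_regions_disjoint rho sigma u v : touch rho u v -> touch sigma u v ->
  region_size rho < 10 -> region_size sigma < 10 -> rho = sigma.
Proof.
move=> ruv suv small_r small_s; apply/eqP/negPn/negP=> neq_rs.
have [x [y [rvx rxy ryu /andP[ux vy] [only_rv only_ru]]]] := quad_region ruv small_r.
have [x' [y' [svx sxy syu /andP[ux' vy'] [only_sv only_su]]]] :=
  quad_region suv small_s.
have [eq_x|xx'] := eqVneq x x'.
  subst x'; apply: (two_regions_degree deg_gt2 neq_rs _ _ rvx svx only_rv only_sv);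
    by rewrite touch_sym.
have [eq_y|yy'] := eqVneq y y'.
  subst y'; apply: (two_regions_degree deg_gt2 neq_rs ruv suv _ _ only_ru only_su);
    by rewrite touch_sym.
have [auv avx axy ayu] := And4 (touch_adj ruv) (touch_adj rvx) (touch_adj rxy) (touch_adj ryu).
have [avx' axy' ayu'] := And3 (touch_adj svx) (touch_adj sxy) (touch_adj syu).
have xy' : x != y'.
  by apply/eqP=> eq_xy; apply: (no_triangle auv avx); rewrite eq_xy.
have x'y : x' != y.
  by apply/eqP=> eq_xy; apply: (no_triangle auv avx'); rewrite eq_xy.
apply: no6; apply: (@has_cycle6 G [:: v; x; y; u; y'; x']) => //=.
  by rewrite avx axy ayu (adj_sym u) ayu' (adj_sym y') axy' (adj_sym x') avx'.
distinct.
Qed.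

Lemma quad_region_mult rho u v : touch rho u v -> region_size rho < 10 ->
  side_mult rho u v = 1.
Proof.
move=> uv small; have [x [y [_ _ _ _ [_ only_u]]]] := quad_region uv small.
exact: (side_mult1 deg_gt2 uv only_u).
Qed.

Lemma no_36 : False.
Proof.
pose small rho := region_size rho < 10.
(* Regions of length at least 5 have size at least 10 and give 4 per counted side; quadrilaterals
   have size at least 8 and give 5. *)
have size40 rho u v : touch rho u v -> 40 <= (4 + small rho) * region_size rho.
  move=> uv; have [c [size_c cyc_c _ le_c]] := region_cycle deg_gt2 uv.
  have c3 : size c <> 3 by move=> eq3; apply: no3; split=> //; exists c.
  by rewrite /small; case: (ltnP (region_size rho)) => /=; lia.
pose tau v := \sum_(w in nbrs A v) (small (reg v w true) + small (reg v w false)).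
have one_small v w : v \in A -> w \in nbrs A v ->
    small (reg v w true) + small (reg v w false)
    = small (reg v w true) (+) small (reg v w false).
  move=> vA wv; case st: (small (reg v w true)); case sf: (small (reg v w false)) => //=.
  have tt := touch_reg D true vA wv; have tf := touch_reg D false vA wv.
  have := quad_region_mult tt st; rewrite /side_mult.
  by rewrite (quad_regions_disjoint tt tf st sf) !eqxx.
have tau_even v : v \in A -> ~~ odd (tau v) /\ tau v <= deg v.
  move=> vA; have -> : tau v = #|[set w in nbrs A v |
      small (reg v w true) (+) small (reg v w false)]|.
    rewrite -sum1_card /tau; under [RHS]eq_bigl => w do rewrite inE.
    rewrite big_mkcondr; apply: eq_bigr => w wv; rewrite one_small //.
  split; last by apply/subset_leq_card/subsetP=> w; rewrite inE => /andP[].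
  have := region_even [set rho | small rho] vA.
  by congr (~~ odd #|pred_of_set _|); apply/setP=> w; rewrite !inE.
have := charge size40.
have -> : \sum_(v in A) \sum_(w in nbrs A v)
    (4 + small (reg v w true) + (4 + small (reg v w false))) =
    8 * \sum_(v in A) deg v + \sum_(v in A) tau v.
  rewrite big_distrr -big_split; apply: eq_bigr => v _ /=.
  by rewrite mulnC -sum_nat_const -big_split; apply: eq_bigr => w _ /=; lia.
have tau3 : \sum_(v in A | deg v == 3) tau v <= 2 * n3.
  rewrite -(@sum_cond_const (fun v => deg v == 3) (fun=> 2)) //.
  by apply: leq_sum => v /andP[/tau_even[]]; lia.
have tau4 : \sum_(v in A | deg v == 4) tau v <= 4 * n4.
  rewrite -(@sum_cond_const (fun v => deg v == 4) (fun=> 4)) //.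
  by apply: leq_sum => v /andP[/tau_even[]]; lia.
(* At degree d >= 5 this says [tau v] + 40 <= (9 - 1/20) d. For d = 5 it relies on [tau v] being
   even, hence at most 4. The spare 1/20 makes the final comparison strict. *)
have tau5 : 20 * \sum_(v in A | 4 < deg v) tau v + 800 * n5 + degsum5 <= 180 * degsum5.
  rewrite -(@sum_cond_const (fun v => 4 < deg v) (fun=> 800)) //.
  rewrite !big_distrr -!big_split.
  by apply: leq_sum => v /andP[/tau_even[]] /=; lia.
rewrite (sum_by_degree tau).
(* The charges give 4 n4 + (3 + 1/20) [degsum5] <= 6 n3, whereas these two lemmas give 2 n3 <= n4 +
   [degsum5]. *)
have := count3; have := forest34; have := A_gt0.
rewrite degree_sum card_by_degree; have := n5_leq; move: tau3 tau4 tau5.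
set e34 := \sum_(v in A | deg v == 3) \sum_(w in nbrs A v | _) 1.
move: (n5) (n4) (n3) degsum5 e34 => a b c d e.
move: (\sum_(v in A | deg v == 3) tau v) (\sum_(v in A | deg v == 4) tau v).
move: (\sum_(v in A | _) tau v) => t1 t2 t3; lia.
Qed.
End TriangleAndHexagonFree.

End Counting.

(** * Graphs without 4- and 6-cycles *)

Section QuadAndHexagonFree.
Variables (G : sgraph) (A : {set G}).
Hypothesis A_indec : ~ decomposable A.
Hypothesis A_min : forall B : {set G}, B \proper A -> decomposable B.
Variable D : drawing A.
Hypotheses (no4 : ~ has_cycle G 4) (no6 : ~ has_cycle G 6).

Notation deg v := #|nbrs A v|.
Notation reg := (@region G A D).
Implicit Types (u v w x y z a b c : G) (rho sigma : regions D).

Let deg_gt2 v : v \in A -> 2 < deg v.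
Proof. exact: (deg_ge3 A_indec A_min). Qed.

Lemma no_quad a b c d : adj a b -> adj b c -> adj c d -> adj d a ->
  a != c -> b != d -> False.
Proof. by move=> ab bc cd da ac /(has_cycle4 ab bc cd da ac). Qed.

Lemma common_nbr_unique a b x y : adj a b -> adj a x -> adj b x ->
  adj a y -> adj b y -> x = y.
Proof.
move=> ab ax bx ay By; apply/eqP/negPn/negP=> xy.
by apply: (@no_quad a x b y); rewrite // 1?(adj_sym x) 1?(adj_sym y) // adj_neq.
Qed.

Lemma triangle_region rho u v : touch rho u v -> region_size rho < 8 ->
  exists w, [/\ touch rho u w, touch rho v w,
    side_mult rho u v = 1 & forall x y, touch rho x y -> x \in [:: u; v; w]].
Proof.
move=> uv small; have vu : touch rho v u by rewrite touch_sym.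
have [w wu vw] := touch_next deg_gt2 uv.
have auv := touch_adj uv; have avw := touch_adj vw.
have only x y : touch rho x y -> x \in [:: u; v; w].
  move=> xy; apply: contraTT small => x_out; rewrite -leqNgt.
  apply: (@region_size_touched _ _ _ deg_gt2 rho [:: x; u; v; w]).
    by rewrite cons_uniq x_out; distinct.
  by rewrite /= (touchedl xy) (touchedl uv) (touchedl vu) (touchedr vw).
have uw : touch rho u w.
  have [x xv ux] := touch_next deg_gt2 vu.
  have := only x u; rewrite touch_sym => /(_ ux); rewrite !inE.
  case/or3P=> /eqP eq_x; last by rewrite -eq_x.
    by rewrite eq_x touch_irr in ux.
  by rewrite eq_x eqxx in xv.
exists w; split=> //; apply: (side_mult1 deg_gt2 (z := w) uv) => x ux.
have := only x u; rewrite touch_sym => /(_ ux); rewrite !inE.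
by case/or3P=> [/eqP eq_x|->|->]; rewrite ?orbT // eq_x touch_irr in ux *.
Qed.

(** The boundary contains a cycle of length at least 5, which suffices, or a triangle. A touched
    vertex off the triangle leads either to five touched vertices or to a 4-cycle; if there is none,
    the size is only 6. *)
Lemma region_size_gap rho u v : touch rho u v -> 8 <= region_size rho ->
  10 <= region_size rho.
Proof.
move=> uv size8; have [c [size_c cyc_c /andP[cyc uniq_c] le_c]] := region_cycle deg_gt2 uv.
have c4 : size c <> 4 by move=> eq4; apply: no4; split=> //; exists c.
case: (ltngtP (size c) 3) => [|ge4|eq3]; [lia | lia |].
case: c eq3 uniq_c cyc {size_c cyc_c c4 le_c} => [|x [|y [|z []]]] //= _ uniq_c.
case/and4P=> xy yz zx _.
have [axy ayz azx] := And3 (touch_adj xy) (touch_adj yz) (touch_adj zx).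
have [yx zy xz] : [/\ touch rho y x, touch rho z y & touch rho x z].
  by split; rewrite touch_sym.
have [tx ty tz] := And3 (touchedl xy) (touchedl yz) (touchedl zx).
have [/existsP[p /andP[p_out /existsP[q pq]]]|no_p] :=
    boolP [exists p, (p \notin [:: x; y; z]) && touched rho p].
  have five q' : touch rho p q' -> q' \notin [:: x; y; z] -> 10 <= region_size rho.
    move=> pq' q'_out.
    apply: (@region_size_touched _ _ _ deg_gt2 rho [:: p, q' & [:: x; y; z]]).
      by rewrite cons_uniq inE negb_or (touch_neq pq') p_out cons_uniq q'_out.
    by rewrite /= (touchedl pq') (touchedr pq') tx ty tz.
  have qp : touch rho q p by rewrite touch_sym.
  have [q' q'q pq'] := touch_next deg_gt2 qp.
  have [q_in|q_out] := boolP (q \in [:: x; y; z]); last exact: five pq q_out.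
  have [q'_in|q'_out] := boolP (q' \in [:: x; y; z]); last exact: five pq' q'_out.
  (* [r] is the third vertex of the triangle, and [p q r q'] is a 4-cycle. *)
  have [r [rq rq' pr]] : exists r, [/\ adj q r, adj r q' & p != r].
    move: p_out q_in q'_in q'q; rewrite !inE !negb_or => /and3P[px py pz].
    move=> /or3P[]/eqP-> /or3P[]/eqP->; rewrite ?eqxx // => _.
    - by exists z; rewrite adj_sym azx adj_sym ayz.
    - by exists y; rewrite axy ayz.
    - by exists z; rewrite ayz azx.
    - by exists x; rewrite adj_sym axy adj_sym azx.
    - by exists y; rewrite adj_sym ayz adj_sym axy.
    - by exists x; rewrite azx axy.
  case: (@no_quad p q r q') => //; first exact: touch_adj pq.
    by rewrite adj_sym (touch_adj pq').
  by rewrite eq_sym.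
have in_xyz p q : touch rho p q -> p \in [:: x; y; z].
  move=> pq; apply: contraNT no_p => p_out; apply/existsP; exists p.
  by rewrite p_out (touchedl pq).
have sides2 p q r : touch rho p q -> touch rho p r -> q != r ->
    (forall w, touch rho p w -> w \in [:: q; r]) -> sides_at rho p <= 2.
  move=> pq pr qr only; have only' w : touch rho p w -> w \in [:: r; q].
    by move/only; rewrite !inE orbC.
  have mq := side_mult1 deg_gt2 pq only; have mr := side_mult1 deg_gt2 pr only'.
  rewrite /sides_at (big_setD1 q) ?(touch_nbrs pq) //= mq.
  rewrite (big_setD1 r) /=; last by rewrite in_setD1 eq_sym qr (touch_nbrs pr).
  rewrite mr big1 // => w; rewrite !in_setD1 => /and3P[wr wq wp].
  apply/eqP; rewrite -leqn0 leqNgt; apply/negP=> m_gt0.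
  have : touch rho p w by rewrite /touch /= (touchA pq) wp.
  by move/only; rewrite !inE (negPf wr) (negPf wq).
have only p q : touch rho p q -> q \in [:: x; y; z].
  by rewrite touch_sym; apply: in_xyz.
have size6 : region_size rho <= \sum_(p <- [:: x; y; z]) 2.
  rewrite /region_size (bigID (mem [:: x; y; z])) /= [X in _ + X]big1 ?addn0; last first.
    move=> p /andP[pA p_out]; apply: big1 => w wp; apply/eqP.
    rewrite -leqn0 leqNgt; apply: contra p_out => m_gt0.
    by apply: (in_xyz p w); rewrite /touch /= pA wp.
  rewrite (big_uniq _ (uniq_c : uniq [:: x; y; z])) /= big_mkcondl /=; apply: leq_sum => p p_in.
  case: ifP => // _; move: p_in; rewrite !inE => /or3P[]/eqP->.
  - apply: (sides2 x y z) => //; first exact: (touch_neq yz).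
    move=> w xw; have := only _ _ xw; rewrite !inE => /or3P[/eqP eq_w|->|->];
      by rewrite ?orbT // eq_w touch_irr in xw *.
  - apply: (sides2 y x z) => //; first by rewrite (touch_neq xz).
    move=> w yw; have := only _ _ yw; rewrite !inE => /or3P[->|/eqP eq_w|->];
      by rewrite ?orbT // eq_w touch_irr in yw *.
  - apply: (sides2 z x y) => //; first by rewrite (touch_neq xy).
    move=> w zw; have := only _ _ zw; rewrite !inE => /or3P[->|->|/eqP eq_w];
      by rewrite ?orbT // eq_w touch_irr in zw *.
by move: size6; rewrite big_const_seq => /(leq_trans size8).
Qed.

(** The detour from [u] to [v] through [w] turns the pentagon into a hexagon; if [w] already lies on
    the pentagon, a chord cuts off a 4-cycle. *)
Lemma no_pentagon_on_triangle u v w x y z : adj u v -> adj u w -> adj v w ->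
  adj v x -> adj x z -> adj z y -> adj y u -> uniq [:: u; v; x; z; y] -> False.
Proof.
move=> uv uw vw vx xz zy yu /=; rewrite !inE !negb_or !andbT.
case/and4P=> /and4P[_ ux uz _] /and3P[_ vz vy] /andP[_ xy] _.
have wu : adj w u by rewrite adj_sym.
have [eq_x|wx] := eqVneq w x.
  by subst w; apply: (@no_quad u x z y).
have [eq_y|wy] := eqVneq w y.
  subst w; apply: (@no_quad v x z y) => //; by rewrite adj_sym.
have [eq_z|wz] := eqVneq w z.
  by subst w; apply: (@no_quad u v x z).
apply: no6; apply: (@has_cycle6 G [:: u; w; v; x; z; y]) => //.
  by rewrite /= uw (adj_sym w) vw vx xz zy yu.
by distinct.
Qed.

(** If [sigma] does not touch both [u w] and [v w], two steps along it from [v] and two from [u]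
    give six distinct vertices, as 4- and 6-cycles are excluded. A seventh vertex makes the size 14;
    otherwise the third steps return to [v] and to [u]. *)
Lemma long_or_triangle sigma u v w : touch sigma u v -> adj u w -> adj v w ->
  14 <= region_size sigma \/ touch sigma u w /\ touch sigma v w.
Proof.
move=> uv uw vw; have vu : touch sigma v u by rewrite touch_sym.
have [auv avu] := (touch_adj uv, touch_adj vu).
have [x xu vx] := touch_next deg_gt2 uv; have avx := touch_adj vx.
have [y yv uy] := touch_next deg_gt2 vu; have auy := touch_adj uy.
have xv : touch sigma x v by rewrite touch_sym.
have yu : touch sigma y u by rewrite touch_sym.
have [axv ayu] := (touch_adj xv, touch_adj yu).
have wu : adj w u by rewrite adj_sym.
have wv : adj w v by rewrite adj_sym.
have [/andP[uw' vw']|no_w] := boolP (touch sigma u w && touch sigma v w); first by right.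
left; have no_tri p : touch sigma u p -> touch sigma v p -> False.
  move=> up vp; case/negP: no_w.
  by rewrite -(common_nbr_unique auv (touch_adj up) (touch_adj vp) uw vw) up vp.
have xy : x != y.
  by apply/eqP=> eq_xy; apply: (no_tri x) => //; rewrite eq_xy.
have [x' x'v xx'] := touch_next deg_gt2 vx; have axx' := touch_adj xx'.
have [y' y'u yy'] := touch_next deg_gt2 uy; have ayy' := touch_adj yy'.
have ax'x : adj x' x by rewrite adj_sym.
have ay'y : adj y' y by rewrite adj_sym.
have x'u : x' != u.
  by apply/eqP=> eq_x'; subst x'; apply: (no_tri x) => //; rewrite touch_sym.
have y'v : y' != v.
  by apply/eqP=> eq_y'; subst y'; apply: (no_tri y) => //; rewrite touch_sym.
have x'y : x' != y.
  by apply/eqP=> eq_x'; subst x'; apply: (@no_quad u v x y); rewrite // eq_sym.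
have y'x : y' != x.
  by apply/eqP=> eq_y'; subst y'; apply: (@no_quad u v x y); rewrite // eq_sym.
have x'y' : x' != y'.
  apply/eqP=> eq_x'; subst y'.
  by apply: (no_pentagon_on_triangle auv uw vw avx axx' ay'y ayu) => //; distinct.
have tx := touchedr vx; have ty := touchedr uy; have tu := touchedl uv.
have tv := touchedl vu; have tx' := touchedr xx'; have ty' := touchedr yy'.
have six : uniq [:: x'; x; v; u; y; y'] by distinct.
have tou6 : all (touched sigma) [:: x'; x; v; u; y; y'].
  by rewrite /= tx' tx tv tu ty ty'.
have seventh p : touched sigma p -> p \notin [:: x'; x; v; u; y; y'] ->
    14 <= region_size sigma.
  move=> tp p_out.
  apply: (@region_size_touched _ _ _ deg_gt2 sigma [:: p, x' & [:: x; v; u; y; y']]).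
    by rewrite cons_uniq p_out.
  by rewrite /= tp tx' tx tv tu ty ty'.
have [x'' x''x x'x''] := touch_next deg_gt2 xx'; have ax'x'' := touch_adj x'x''.
have [y'' y''y y'y''] := touch_next deg_gt2 yy'; have ay'y'' := touch_adj y'y''.
have [x''_in|] := boolP (x'' \in [:: x'; x; v; u; y; y']); last first.
  by apply: seventh; apply: touchedr x'x''.
have [y''_in|] := boolP (y'' \in [:: x'; x; v; u; y; y']); last first.
  by apply: seventh; apply: touchedr y'y''.
have hexagon : adj x' y' -> False.
  move=> ax'y'; apply: no6; apply: (@has_cycle6 G [:: x'; x; v; u; y; y']) => //.
  by rewrite /= ax'x axv avu auy ayy' adj_sym ax'y'.
have x''v : x'' = v.
  move: x''_in; rewrite !inE => /or3P[/eqP eq_x|/eqP eq_x|/or4P[/eqP//|/eqP eq_x|/eqP eq_x|/eqP eq_x]].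
  - by rewrite eq_x touch_irr in x'x''.
  - by rewrite eq_x eqxx in x''x.
  - by subst x''; case: (@no_quad u v x x'); rewrite // eq_sym.
  - subst x''; case: (no_pentagon_on_triangle auv uw vw avx axx' ax'x'' ayu).
    by distinct.
  - by subst x''; case: hexagon.
have y''u : y'' = u.
  move: y''_in; rewrite !inE => /or3P[/eqP eq_y|/eqP eq_y|/or4P[/eqP eq_y|/eqP//|/eqP eq_y|/eqP eq_y]].
  - by case: hexagon; rewrite adj_sym -eq_y.
  - subst y''; case: (no_pentagon_on_triangle avu vw uw auy ayy' ay'y'' axv).
    by distinct.
  - by subst y''; case: (@no_quad v u y y'); rewrite // eq_sym.
  - by rewrite eq_y eqxx in y''y.
  - by rewrite eq_y touch_irr in y'y''.
subst x'' y''.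
(* Now [sigma] touches the triangles [v x x'] and [u y y'] joined by [u v]: at least three sides at
   [u] and at [v] and two at the other four vertices, 14 in all. *)
have s3v : 3 <= sides_at sigma v.
  apply: (sides_at_geq (s := [:: u; x; x'])); first by distinct.
  by rewrite /= vu vx touch_sym x'x''.
have s3u : 3 <= sides_at sigma u.
  apply: (sides_at_geq (s := [:: v; y; y'])); first by distinct.
  by rewrite /= uv uy touch_sym y'y''.
have subA : {subset [:: x'; x; v; u; y; y'] <= A}.
  by move=> p /(allP tou6)/existsP[q /touchA].
have := region_size_geq sigma six subA; rewrite /=.
have s2 p q : touch sigma p q -> 1 < sides_at sigma p by apply: sides_at_ge2.
move: (s2 _ _ xx') (s2 _ _ yy') (s2 _ _ x'x'') (s2 _ _ y'y'') s3v s3u.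
clear; lia.
Qed.

(** If [long_or_triangle] does not settle it, [sigma] touches all three edges of the triangle. By
    [two_regions_degree] it has a further edge at each corner; excluding 4-cycles, the other ends
    are distinct, and the size is at least 3 * 3 + 3 * 2 = 15. *)
Lemma across_triangle u v d : u \in A -> v \in nbrs A u ->
  region_size (reg u v d) < 8 -> 14 <= region_size (reg u v (~~ d)).
Proof.
move=> uA vu small; set rho := reg u v d in small *; set sigma := reg u v (~~ d).
have ruv : touch rho u v by apply: touch_reg.
have suv : touch sigma u v by apply: touch_reg.
have [w [ruw rvw mult1 only]] := triangle_region ruv small.
have neq_rs : rho != sigma.
  apply: contra_eq_neq mult1 => eq_rs; rewrite /side_mult /sigma in eq_rs *.
  by rewrite /rho in eq_rs *; case: (d) eq_rs => /= ->; rewrite eqxx.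
have [//|[suw svw]] := long_or_triangle suv (touch_adj ruw) (touch_adj rvw).
have [rvu rwu rwv] : [/\ touch rho v u, touch rho w u & touch rho w v].
  by split; rewrite touch_sym.
have [svu swu swv] : [/\ touch sigma v u, touch sigma w u & touch sigma w v].
  by split; rewrite touch_sym.
have [auv auw avw] := And3 (touch_adj ruv) (touch_adj ruw) (touch_adj rvw).
have third a b c : touch rho a b -> touch sigma a b -> touch rho a c ->
    touch sigma a c -> (forall x, x \in [:: u; v; w] -> x \in [:: a; b; c]) ->
    exists2 p, touch sigma a p & p \notin [:: b; c].
  move=> rab sab rac sac sub_abc; apply: NNPP => no_p.
  apply: (two_regions_degree deg_gt2 neq_rs rab sab rac sac) => p ap.
    have := sub_abc p (only p a _); rewrite touch_sym => /(_ ap).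
    by rewrite in_cons => /orP[/eqP eq_p|//]; rewrite eq_p touch_irr in ap.
  by apply/negPn/negP=> p_out; apply: no_p; exists p.
have [u' suu'] : exists2 p, touch sigma u p & p \notin [:: v; w] by apply: third.
have [v' svv'] : exists2 p, touch sigma v p & p \notin [:: u; w].
  by apply: third => // x; rewrite !inE => /or3P[]->; rewrite ?orbT.
have [w' sww'] : exists2 p, touch sigma w p & p \notin [:: u; v].
  by apply: third => // x; rewrite !inE => /or3P[]->; rewrite ?orbT.
rewrite !inE !negb_or => /andP[w'u w'v] /andP[v'u v'w] /andP[u'v u'w].
have [auu' avv' aww'] := And3 (touch_adj suu') (touch_adj svv') (touch_adj sww').
have awv : adj w v by rewrite adj_sym.
have awu : adj w u by rewrite adj_sym.
have avu : adj v u by rewrite adj_sym.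
have u'v' : u' != v'.
  apply: contra_not_neq (negP u'w) => eq_p; subst v'; apply/eqP.
  exact: (common_nbr_unique auv).
have u'w' : u' != w'.
  apply: contra_not_neq (negP u'v) => eq_p; subst w'; apply/eqP.
  exact: (common_nbr_unique auw).
have v'w' : v' != w'.
  apply: contra_not_neq (negP v'u) => eq_p; subst w'; apply/eqP.
  exact: (common_nbr_unique avw).
have s3u : 3 <= sides_at sigma u.
  apply: (sides_at_geq (s := [:: v; w; u'])); first by distinct.
  by rewrite /= suv suw suu'.
have s3v : 3 <= sides_at sigma v.
  apply: (sides_at_geq (s := [:: u; w; v'])); first by distinct.
  by rewrite /= svu svw svv'.
have s3w : 3 <= sides_at sigma w.
  apply: (sides_at_geq (s := [:: u; v; w'])); first by distinct.
  by rewrite /= swu swv sww'.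
have s2 p q : touch sigma p q -> 1 < sides_at sigma q.
  by rewrite touch_sym; apply: sides_at_ge2.
have uniq6 : uniq [:: u; v; w; u'; v'; w'] by distinct.
have subA : {subset [:: u; v; w; u'; v'; w'] <= A}.
  have [uA' vA' wA'] := And3 (touchA suv) (touchA svu) (touchA swu).
  have [u'A v'A w'A] := And3 (nbrs_sub (touch_nbrs suu'))
    (nbrs_sub (touch_nbrs svv')) (nbrs_sub (touch_nbrs sww')).
  by apply/allP; rewrite /= uA' vA' wA' u'A v'A w'A.
have := region_size_geq sigma uniq6 subA; rewrite /=.
move: (s2 _ _ suu') (s2 _ _ svv') (s2 _ _ sww') s3u s3v s3w; clear; lia.
Qed.

Notation small rho := (region_size rho < 8).
Notation large rho := (14 <= region_size rho).

Definition on_triangle v w := small (reg v w true) || small (reg v w false).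

Definition triangle_degree v := #|[set w in nbrs A v | on_triangle v w]|.

Lemma on_triangle_addb v w : v \in A -> w \in nbrs A v ->
  on_triangle v w = small (reg v w true) (+) small (reg v w false).
Proof.
move=> vA wv; rewrite /on_triangle; have := @across_triangle v w true vA wv.
by case: (ltnP _ 8) => //= _ /(_ isT); case: ltnP => //=; lia.
Qed.

Lemma triangle_degree_even v : v \in A -> ~~ odd (triangle_degree v).
Proof.
move=> vA; rewrite (_ : triangle_degree v = #|[set w in nbrs A v |
    (reg v w true \in [set rho | small rho]) (+)
    (reg v w false \in [set rho | small rho])]|); first exact: region_even.
apply: eq_card => w; rewrite in_set [RHS]in_set.
by case wv: (w \in nbrs A v) => //=; rewrite on_triangle_addb // !in_set.
Qed.

Lemma triangle_degree_leq v : triangle_degree v <= deg v.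
Proof. by apply/subset_leq_card/subsetP=> w; rewrite inE => /andP[]. Qed.

(* The constants come from 210 = 6 * 35 = 14 * 15 = 10 * 21. *)
Definition region_charge rho := if small rho then 35 else if large rho then 15 else 21.

Lemma region_charge_geq rho u v : touch rho u v ->
  210 <= region_charge rho * region_size rho.
Proof.
move=> uv; rewrite /region_charge; case: (ltnP _ 8) => [_|/(region_size_gap uv)].
  have [c [size_c _ _]] := region_cycle deg_gt2 uv; lia.
by case: (leqP 14); lia.
Qed.

(* By parity, the union [S] of the triangular and the large regions either has
   at least two edges at [v] on its boundary, or contains all sides at [v]. *)
Lemma large_sides v : v \in A -> 0 < triangle_degree v < deg v ->
  2 <= \sum_(w in nbrs A v | ~~ on_triangle v w)
         (large (reg v w true) + large (reg v w false)).
Proof.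
move=> vA /andP[/card_gt0P[w0 w0T] tri_lt].
have [w0v tri0] : w0 \in nbrs A v /\ on_triangle v w0.
  by move: w0T; rewrite in_set => /andP[].
pose S := [set rho : regions D | small rho || large rho].
pose X := [set w in nbrs A v | (reg v w true \in S) (+) (reg v w false \in S)].
have inS w d : w \in nbrs A v -> on_triangle v w -> reg v w d \in S.
  move=> wv; rewrite /on_triangle inE => /orP[] tri.
    by case: d; rewrite ?tri // (@across_triangle v w true) ?orbT.
  by case: d; rewrite ?tri // (@across_triangle v w false) ?orbT.
have notT w d : ~~ on_triangle v w -> (reg v w d \in S) = large (reg v w d).
  by rewrite negb_or inE => /andP[t f]; case: d; rewrite ?(negPf t) ?(negPf f).
have [X0|[x xX]] := set_0Vmem X.
  have [y yv ynT] : exists2 y, y \in nbrs A v & ~~ on_triangle v y.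
    have [y yv] : exists y, y \in nbrs A v :\: [set w in nbrs A v | on_triangle v w].
      apply/card_gt0P; rewrite cardsD (setIidPr _) ?subn_gt0 //.
      by apply/subsetP=> w; rewrite in_set => /andP[].
    by move: yv; rewrite in_setD in_set negb_and => /andP[/orP[/negPf->|? ?]] //; exists y.
  have allS d : reg v y d \in S.
    apply: (@region_closed _ _ D S v vA _ w0 y true d w0v yv); last exact: inS.
    move=> w wv; have : w \notin X by rewrite X0 inE.
    by rewrite in_set wv /=; do 2![case: (_ \in S)].
  rewrite (bigD1 y) ?yv //=; move: (allS true) (allS false).
  by rewrite !notT // => -> ->.
have : 1 < #|X|.
  have : 0 < #|X| by apply/card_gt0P; exists x.
  by have := region_even S vA; rewrite -/X; lia.
move/leq_trans; apply; rewrite -sum1_card; under eq_bigl => w do rewrite in_set.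
rewrite big_mkcondr [leqRHS]big_mkcondr /=; apply: leq_sum => w wv.
case: ifP => // wX; case: ifP => [nT|/negbFE T]; last first.
  by rewrite !inS in wX.
by move: wX; rewrite !notT //; case: (large _); case: (large _).
Qed.

Definition partial_triangles v : bool := 0 < triangle_degree v < deg v.

(** An edge on a triangle receives 35 and, from the large region across, 15: 50 = 42 + 8. Any other
    edge receives at most 42 = 2 * 21, less 6 = 21 - 15 for each large side; [large_sides] provides
    two of these if only some of the edges lie on triangles. *)
Lemma charge_at v : v \in A ->
  \sum_(w in nbrs A v) (region_charge (reg v w true) + region_charge (reg v w false))
    + 12 * partial_triangles v <= 42 * deg v + 8 * triangle_degree v.
Proof.
move=> vA.
have tri w : w \in nbrs A v -> on_triangle v w ->
    region_charge (reg v w true) + region_charge (reg v w false) <= 50.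
  move=> wv; rewrite /on_triangle /region_charge.
  have := @across_triangle v w true vA wv; have := @across_triangle v w false vA wv.
  case st: (small (reg v w true)); case: (small (reg v w false)) => //=.
  - by move=> /(_ isT) large_t; move: st; rewrite ltnNge (leq_trans _ large_t).
  - by move=> _ /(_ isT) ->.
  - by move=> /(_ isT) ->.
have notri w : ~~ on_triangle v w ->
    region_charge (reg v w true) + region_charge (reg v w false) +
    6 * (large (reg v w true) + large (reg v w false)) <= 42.
  rewrite /on_triangle /region_charge negb_or => /andP[/negPf-> /negPf->].
  by case: (large (reg v w true)); case: (large (reg v w false)).
rewrite (bigID (on_triangle v)) /=.
set T := \sum_(w in nbrs A v | on_triangle v w) _.
set N := \sum_(w in nbrs A v | ~~ on_triangle v w) _.
have leT : T <= 50 * triangle_degree v.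
  rewrite mulnC -sum_nat_const /triangle_degree; under [leqRHS]eq_bigl => w do rewrite in_set.
  by apply: leq_sum => w /andP[wv]; apply: tri.
pose L := \sum_(w in nbrs A v | ~~ on_triangle v w)
         (large (reg v w true) + large (reg v w false)).
have leN : N + 6 * L <= 42 * (deg v - triangle_degree v).
  rewrite /N /L big_distrr -big_split /=.
  have -> : deg v - triangle_degree v = #|[set w in nbrs A v | ~~ on_triangle v w]|.
    rewrite -(cardsID [set w | on_triangle v w] (nbrs A v)) /triangle_degree.
    rewrite (_ : nbrs A v :&: _ = [set w in nbrs A v | on_triangle v w]); last first.
      by apply/setP=> w; rewrite !in_set.
    rewrite addKn; apply: eq_card => w; rewrite !in_set; exact: andbC.
  rewrite mulnC -sum_nat_const; under [leqRHS]eq_bigl => w do rewrite in_set.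
  by apply: leq_sum => w /andP[_]; apply: notri.
have leL : 2 * partial_triangles v <= L.
  rewrite /partial_triangles; case: (boolP (_ && _)) => // part; exact: large_sides.
have := triangle_degree_leq v; lia.
Qed.

Definition nbrs3 v := [set w in nbrs A v | deg w == 3].

Lemma triangle_partner u v : u \in A -> v \in nbrs A u -> on_triangle u v ->
  exists w, w \in nbrs A u /\ w \in nbrs A v.
Proof.
move=> uA vu tri; have [d small] : exists d, small (reg u v d).
  by case/orP: tri; [exists true | exists false].
have [w [uw vw _ _]] := triangle_region (touch_reg D d uA vu) small.
by exists w; rewrite (touch_nbrs uw) (touch_nbrs vw).
Qed.

(* Such a 4-vertex can spare little; the vertex [b] makes up for it. *)
Lemma surrounded_4 u : u \in A -> deg u = 4 -> triangle_degree u = 4 ->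
  #|nbrs3 u| <= 2 /\ (1 < #|nbrs3 u| -> forall v, v \in nbrs3 u ->
    exists2 b, b \in nbrs A v :\ u & 4 < deg b).
Proof.
move=> uA du tu.
have tri v : v \in nbrs A u -> on_triangle u v.
  have : [set w in nbrs A u | on_triangle u w] == nbrs A u.
    rewrite eqEcard -/(triangle_degree u) tu du leqnn andbT.
    by apply/subsetP=> w; rewrite in_set => /andP[].
  by move/eqP=> eqT; rewrite -{1}eqT in_set => /andP[].
have partner v : exists w, v \in nbrs A u -> w \in nbrs A u /\ w \in nbrs A v.
  have [vu|] := boolP (v \in nbrs A u); last by exists v.
  by have [w wP] := triangle_partner uA vu (tri v vu); exists w.
have [p pP] := fin_all_exists partner.
have in3 v : v \in nbrs3 u -> v \in nbrs A u /\ deg v = 3.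
  by rewrite in_set => /andP[? /eqP].
have p_deg v : v \in nbrs3 u -> 3 < deg (p v).
  move=> /in3[vu dv]; have [_ pv] := pP v vu.
  exact: (nbr_of_3 A_indec A_min (nbrs_sub vu) pv dv).
have p_inj : {in nbrs3 u &, injective p}.
  move=> v v' /in3[vu _] /in3[v'u _] eq_p; apply/eqP/negPn/negP=> vv'.
  have [pu pv] := pP v vu; have [_] := pP v' v'u; rewrite -eq_p => pv'.
  apply: (@no_quad u v (p v) v'); rewrite ?(nbrs_adj vu) ?(nbrs_adj pv) //.
  - by rewrite adj_sym (nbrs_adj pv').
  - by rewrite adj_sym (nbrs_adj v'u).
  - by rewrite eq_sym (nbrs_neq pu).
split.
  (* The third vertices of the triangles at the 3-neighbors are distinct and of degree at least 4,
     so at most half of the neighbors have degree 3. *)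
  have subD : p @: nbrs3 u \subset nbrs A u :\: nbrs3 u.
    apply/subsetP=> _ /imsetP[v v3 ->]; have [pu _] := pP v (in3 v v3).1.
    rewrite in_setD pu andbT in_set pu /=; have := p_deg v v3; lia.
  have := subset_leq_card subD; rewrite (card_in_imset p_inj) cardsD.
  rewrite (setIidPr _) ?du; first lia.
  by apply/subsetP=> w /in3[].
move=> gt1 v v3; have [vu dv] := in3 v v3; have [pu pv] := pP v vu.
have [v' v'3 v'v] : exists2 v', v' \in nbrs3 u & v' != v.
  have /card_gt0P[v'] : 0 < #|nbrs3 u :\ v| by move: gt1; rewrite (cardsD1 v) v3; lia.
  by rewrite in_setD1 => /andP[? ?]; exists v'.
have [v'u dv'] := in3 v' v'3; have vA := nbrs_sub vu.
exists (p v); first by rewrite in_setD1 (nbrs_neq pu) pv.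
rewrite ltnNge; apply/negP=> le4; have dp : deg (p v) = 4.
  by have := p_deg v v3; lia.
exact: (no_344_with_3 A_indec A_min vA (nbrs_sym uA vu) pv pu v'u v'v dv du dp dv').
Qed.

Definition poor u := (triangle_degree u == 4) && (1 < #|nbrs3 u|).

(** By [charge] and [charge_at], the values 126 d + 24 p - 420 - 16 t sum to at most 0, where d is
    the degree, t the triangle degree and p stands for [partial_triangles]. A 3-vertex has -42 or
    -50. A 4-vertex has 84, 76 or 20 for t = 0, 2, 4, hence 19 = 76/4 and 10 = 20/2; a 5-vertex has
    at least 170 = 5 * 34. *)
Definition gift u := if 4 < deg u then 34 else if poor u then 10 else 19.

Lemma gift_leq u : u \in A -> 3 < deg u ->
  420 + 16 * triangle_degree u + gift u * #|nbrs3 u|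
    <= 126 * deg u + 24 * partial_triangles u.
Proof.
move=> uA du; have ev := triangle_degree_even uA; have le := triangle_degree_leq u.
have le3 : #|nbrs3 u| <= deg u.
  by apply/subset_leq_card/subsetP=> w; rewrite in_set => /andP[].
have partE : 0 < triangle_degree u < deg u -> partial_triangles u = true by [].
rewrite /gift; case: (ltnP 4 (deg u)) => [gt4|le4].
  have [d5|gt5] : deg u = 5 \/ 5 < deg u by lia.
    have [-> | t_gt0] := posnP (triangle_degree u); first lia.
    by rewrite partE; lia.
  lia.
have d4 : deg u = 4 by lia.
rewrite /poor; have [t4|nt4] := eqVneq (triangle_degree u) 4.
  have [le2 _] := surrounded_4 uA d4 t4.
  by case: ltnP => /= ?; rewrite t4 d4; lia.
rewrite /=; have [t0|t_gt0] := posnP (triangle_degree u); first lia.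
by rewrite partE; lia.
Qed.

(** Either all three gifts are at least 19, or a poor 4-vertex is present and the vertex [b] of
    [surrounded_4] gives 34 beside two gifts of at least 10. The bound 51 exceeds the largest need,
    50, by one. *)
Lemma gift_geq v : v \in A -> deg v = 3 -> 51 <= \sum_(u in nbrs A v) gift u.
Proof.
move=> vA dv.
have u_ge4 u : u \in nbrs A v -> 3 < deg u.
  by move=> uv; apply: (nbr_of_3 A_indec A_min vA uv dv).
have [/exists_inP[u uv poor_u]|no_poor] :=
    boolP [exists u in nbrs A v, (deg u <= 4) && poor u]; last first.
  have -> : 51 = \sum_(u in nbrs A v) 17 by rewrite sum_nat_const dv.
  apply: leq_sum => u uv; rewrite /gift.
  have [//|le4] := ltnP 4 (deg u); case: (boolP (poor u)) => // poor_u; case/negP: no_poor.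
  by apply/exists_inP; exists u => //; rewrite le4.
have uA := nbrs_sub uv; have vu := nbrs_sym vA uv.
case/andP: poor_u => le4 poor_u; have d4 : deg u = 4 by have := u_ge4 u uv; lia.
have [t4 gt1] := andP poor_u; have [_ H] := surrounded_4 uA d4 (eqP t4).
have [|b bv gt4] := H gt1 v; first by rewrite in_set vu dv.
rewrite (big_setD1 u) //= (big_setD1 b) //=.
have gift10 x : 10 <= gift x by rewrite /gift; case: ifP => // _; case: ifP.
have -> : gift b = 34 by rewrite /gift gt4.
have /card_gt0P[y yv] : 0 < #|nbrs A v :\ u :\ b|.
  by move: dv; rewrite (cardsD1 u) uv (cardsD1 b (_ :\ _)) bv; lia.
rewrite (big_setD1 y) //=; have := gift10 u; have := gift10 y; lia.
Qed.

Lemma no_46 : False.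
Proof.
have := charge region_charge_geq.
set C := \sum_(v in A) \sum_(w in nbrs A v) _.
pose T := \sum_(v in A) triangle_degree v.
pose P := \sum_(v in A) partial_triangles v.
have leC : C + 12 * P <= 42 * \sum_(v in A) deg v + 8 * T.
  rewrite /C /P /T !big_distrr -!big_split; apply: leq_sum => v vA; exact: charge_at.
have balance :
    \sum_(v in A) (420 + 16 * triangle_degree v) +
    \sum_(v in A | deg v != 3) gift v * #|nbrs3 v|
    <= \sum_(v in A) (126 * deg v + 24 * partial_triangles v) +
       \sum_(v in A | deg v == 3) 50.
  rewrite (bigID (fun v => deg v == 3)) [X in _ <= X + _](bigID (fun v => deg v == 3)) /=.
  rewrite -addnA -big_split /= addnAC -big_split /=; apply: leq_add.
    apply: leq_sum => v /andP[vA /eqP dv]; rewrite dv.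
    have := triangle_degree_even vA; have := triangle_degree_leq v; rewrite dv.
    rewrite /partial_triangles dv; case: (triangle_degree v) => [|[|[|[|t]]]] //=; lia.
  apply: leq_sum => v /andP[vA dv]; apply: gift_leq => //.
  by have := deg_gt2 vA; lia.
have gifts : \sum_(v in A | deg v == 3) 51 <=
    \sum_(v in A | deg v != 3) gift v * #|nbrs3 v|.
  have -> : \sum_(v in A | deg v != 3) gift v * #|nbrs3 v| =
      \sum_(u in A | deg u != 3) \sum_(v in nbrs A u | deg v == 3) gift u.
    apply: eq_bigr => u _; rewrite mulnC -sum_nat_const.
    by apply: eq_bigl => w; rewrite in_set.
  rewrite (@sum_nbrs_exchange G A (fun u => deg u != 3) (fun v => deg v == 3) (fun u _ => gift u)).
  apply: leq_sum => v /andP[vA /eqP dv]; apply: leq_trans (gift_geq vA dv) _.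
  apply/eq_leq/eq_bigl => u; case uv: (u \in nbrs A v) => //=.
  by have := nbr_of_3 A_indec A_min vA uv dv; lia.
have sumL : \sum_(v in A) (420 + 16 * triangle_degree v) = 420 * #|A| + 16 * T.
  by rewrite big_split /= sum_nat_const mulnC -big_distrr.
have sumR : \sum_(v in A) (126 * deg v + 24 * partial_triangles v)
    = 126 * \sum_(v in A) deg v + 24 * P.
  by rewrite big_split /= -!big_distrr.
have n3_const k : \sum_(v in A | deg v == 3) k = k * #|[set v in A | deg v == 3]|.
  exact: sum_cond_const.
rewrite !n3_const in balance gifts.
rewrite sumL sumR in balance => charge_C.
(* Each 3-vertex receives 51 but lacks at most 50, while the values sum to at most 0. *)
have no_deg3 : #|[set v in A | deg v == 3]| = 0 by lia.
(* With all degrees at least 4, 126 d - 16 t >= 110 d > 420 at every vertex. *)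
have : \sum_(v in A) (421 + 16 * triangle_degree v) <= \sum_(v in A) 126 * deg v.
  apply: leq_sum => v vA; have := deg_gt2 vA; have := triangle_degree_leq v.
  have d3 : deg v != 3.
    by apply: contra_eqN no_deg3 => d3; rewrite -lt0n; apply/card_gt0P; exists v; rewrite in_set vA.
  lia.
rewrite big_split /= sum_nat_const -!big_distrr /= -/T => le421.
by have := A_gt0 A_indec; lia.
Qed.

End QuadAndHexagonFree.

(** * From excluded cycles to the four parameters *)

Lemma embeddable_decomposable (G : sgraph) (S : nonneg_surface) (i j : nat) :
  embeddable G S -> i \in [:: 3; 4; 6] -> j \in [:: 3; 4; 6] -> i != j ->
  ~ has_cycle G i -> ~ has_cycle G j -> decomposable [set: G].
Proof.
move=> G_in_S hi hj hij no_i no_j.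
move: [set: G] => A; have [n] := ubnP #|A|; elim: n A => // n IH A leAn.
apply: NNPP => A_indec.
have A_min (B : {set G}) : B \proper A -> decomposable B.
  by move/proper_card=> ltBA; apply: IH; apply: leq_trans ltBA _.
have [u uA] := A_neq0 A_indec.
have /card_gt0P[v vu] : 0 < #|nbrs A u|.
  exact: leq_trans (deg_ge3 A_indec A_min uA).
have [D] := embeddable_drawing G_in_S uA vu.
move: hi hj hij no_i no_j; rewrite !inE.
move=> /or3P[]/eqP-> /or3P[]/eqP-> //= _ no_i no_j.
- exact: no_34 A_indec A_min D no_i no_j.
- exact: no_36 A_indec A_min D no_i no_j.
- exact: no_34 A_indec A_min D no_j no_i.
- exact: no_46 A_indec A_min D no_i no_j.
- exact: no_36 A_indec A_min D no_j no_i.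
- exact: no_46 A_indec A_min D no_j no_i.
Qed.

Theorem corollary1p5 (G : sgraph) (S : nonneg_surface) (i j : nat)
    (G_in_S : embeddable G S)
    (hi : i \in [:: 3; 4; 6]) (hj : j \in [:: 3; 4; 6]) (hij : i != j)
    (no_i : ~ has_cycle G i) (no_j : ~ has_cycle G j) :
  exists M : {set {set G}}, matching M /\
  exists ch chiP chiDP AT : nat,
    [/\ is_choice_number (delete_edges M) ch /\ ch <= 3,
        is_paint_number (delete_edges M) chiP /\ chiP <= 3,
        is_DP_chromatic_number (delete_edges M) chiDP /\ chiDP <= 3
      & is_Alon_Tarsi_number (delete_edges M) AT /\ AT <= 3].
Proof.
have [M [matchM [r r_inj back2]]] := decomposable_degenerate
  (embeddable_decomposable G_in_S hi hj hij no_i no_j).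
exists M; split=> //.
have [ch chP] := exists_least (degenerate_choosable r_inj back2).
have [chiP chiPP] := exists_least (degenerate_paintable r_inj back2).
have [chiDP chiDPP] := exists_least (degenerate_DP_colorable r_inj back2).
have [AT ATP] := exists_least (degenerate_AT_orientable r_inj back2).
by exists ch, chiP, chiDP, AT.
Qed.
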